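(* Let $R$ be an arithmetical ring satisfying the following two conditions: (a) for each maximal ideal $P$ of $R$, the ring $R_P$ is either coherent or not semicoherent; (b) every finitely generated $R$-module has finite Goldie dimension. Then, for each multiplicative subset $S$ of $R$: if $G$ is a finitely injective $R$-module, then $S^{-1}G$ is finitely injective; and if $G$ is an FP-injective $R$-module, then $S^{-1}G$ is FP-injective. Moreover, if in addition $R_P$ is coherent for each maximal ideal $P$ of $R$, then $R$ is coherent.
   Context: All rings are commutative with unity and all modules are unital. A module is uniserial if its submodules are linearly ordered by inclusion. A ring $R$ is a valuation ring if it is uniserial as an $R$-module (zero divisors are allowed), and $R$ is arithmetical if $R_P$ is a valuation ring for every maximal ideal $P$ of $R$. A ring $R$ is semicoherent if, for any pair of injective $R$-modules $E, F$, the module $\mathrm{Hom}_R(E,F)$ is a submodule of a flat $R$-module. An $R$-module $E$ is FP-injective if $\mathrm{Ext}^1_R(F,E)=0$ for every finitely presented $R$-module $F$. A module $M$ over a ring $R$ is finitely injective if every homomorphism $f:A\to M$ extends to $B$ whenever $A$ is a finitely generated submodule of an arbitrary $R$-module $B$. A module $M$ has Goldie dimension $n$ if its injective hull is a direct sum of $n$ indecomposable injective modules; it has finite Goldie dimension if this holds for some finite $n$. The module $S^{-1}G$ is considered over the ring $S^{-1}R$. *)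

(* Defs.v *)
From HB Require Import structures.
From mathcomp Require Import all_boot all_algebra.
From mathcomp Require Import generic_quotient ring.
From mathcomp Require Import boolp classical_sets functions cardinality fsbigop.

Set Implicit Arguments.
Unset Strict Implicit.
Unset Printing Implicit Defensive.

Import GRing.Theory.

Local Open Scope ring_scope.
Local Open Scope quotient_scope.

(* Rings are commutative with unity and may be trivial ([comPzRingType]).
   Submodules of [M] are the library's [submodClosed M], ideals of [R] are
   [submodClosed R^o], multiplicative subsets of [R] are [mulrClosed R];
   since excluded middle is available, membership being boolean is no
   restriction. *)

Section Submodule.
Context (R : comPzRingType) (M : lmodType R) (N : submodClosed M).

Definition submod : Type := {x : M | x \in N}.

HB.instance Definition _ := SubChoice.copy submod {x : M | x \in N}.
HB.instance Definition _ := [SubChoice_isSubLmodule of submod by <:].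

End Submodule.

Section Quotient.
Context (R : comPzRingType) (M : lmodType R) (N : submodClosed M).

Definition quot_rel : rel M := fun x y => x - y \in N.

Lemma quot_rel_refl : reflexive quot_rel.
Proof. by move=> x; rewrite /quot_rel subrr rpred0. Qed.

Lemma quot_rel_sym : symmetric quot_rel.
Proof.
have H x y : quot_rel x y -> quot_rel y x.
  by rewrite /quot_rel => /(rpredZ (-1)); rewrite scaleN1r opprB.
by move=> x y; apply/idP/idP; apply: H.
Qed.

Lemma quot_rel_trans : transitive quot_rel.
Proof.
move=> y x z; rewrite /quot_rel => xy yz.
by rewrite -[x](subrK y) -addrA rpredD.
Qed.

Definition quot_equiv :=
  EquivRel quot_rel quot_rel_refl quot_rel_sym quot_rel_trans.

Definition quotmod : Type := {eq_quot quot_equiv}.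

HB.instance Definition _ := Choice.copy quotmod {eq_quot quot_equiv}.

Definition qproj (x : M) : quotmod := \pi_({eq_quot quot_equiv}) x.
Definition qrepr (x : quotmod) : M := repr (x : {eq_quot quot_equiv}).

Lemma qreprK : cancel qrepr qproj.
Proof. by move=> x; rewrite /qproj /qrepr reprK. Qed.

Lemma qprojP x y : qproj x = qproj y <-> x - y \in N.
Proof. by split=> [/eqmodP|h]; last exact/eqmodP. Qed.

Lemma qrepr_proj x : qrepr (qproj x) - x \in N.
Proof. by apply/qprojP; rewrite qreprK. Qed.

Definition qadd (x y : quotmod) := locked (qproj (qrepr x + qrepr y)).
Definition qopp (x : quotmod) := locked (qproj (- qrepr x)).
Definition qscale (a : R) (x : quotmod) := locked (qproj (a *: qrepr x)).

Lemma qaddE x y : qadd (qproj x) (qproj y) = qproj (x + y).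
Proof.
rewrite /qadd -lock; apply/qprojP.
by rewrite opprD addrACA rpredD ?qrepr_proj.
Qed.

Lemma qoppE x : qopp (qproj x) = qproj (- x).
Proof.
rewrite /qopp -lock; apply/qprojP; have := rpredZ (-1) (qrepr_proj x).
by rewrite scaleN1r opprD.
Qed.

Lemma qscaleE a x : qscale a (qproj x) = qproj (a *: x).
Proof.
rewrite /qscale -lock; apply/qprojP.
by rewrite -scalerBr rpredZ ?qrepr_proj.
Qed.

Lemma qaddA : associative qadd.
Proof.
move=> x y z; rewrite -[x]qreprK -[y]qreprK -[z]qreprK.
by rewrite !qaddE addrA.
Qed.

Lemma qaddC : commutative qadd.
Proof. by move=> x y; rewrite /qadd addrC. Qed.

Lemma qadd0 : left_id (qproj 0) qadd.
Proof. by move=> x; rewrite -[x]qreprK qaddE add0r. Qed.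

Lemma qaddN : left_inverse (qproj 0) qopp qadd.
Proof. by move=> x; rewrite -[x]qreprK qoppE qaddE addNr. Qed.

HB.instance Definition _ := GRing.isZmodule.Build quotmod qaddA qaddC qadd0 qaddN.

Lemma qscaleA a b x : qscale a (qscale b x) = qscale (a * b) x.
Proof. by rewrite -[x]qreprK !qscaleE scalerA. Qed.

Lemma qscale1 : left_id 1 qscale.
Proof. by move=> x; rewrite -[x]qreprK qscaleE scale1r. Qed.

Lemma qscaleDr : right_distributive qscale +%R.
Proof.
move=> a x y; rewrite -[x]qreprK -[y]qreprK.
rewrite -[_ + _]/(qadd _ _) -[RHS]/(qadd _ _).
by rewrite !(qaddE, qscaleE) scalerDr.
Qed.

Lemma qscaleDl x : {morph qscale^~ x : a b / a + b}.
Proof.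
move=> a b /=; rewrite -[x]qreprK -[RHS]/(qadd _ _).
by rewrite !(qaddE, qscaleE) scalerDl.
Qed.

HB.instance Definition _ :=
  GRing.Zmodule_isLmodule.Build R quotmod qscaleA qscale1 qscaleDr qscaleDl.

Lemma qproj_is_linear : linear qproj.
Proof. by move=> a x y; rewrite -qaddE -qscaleE. Qed.

HB.instance Definition _ :=
  GRing.isLinear.Build R M quotmod *:%R qproj qproj_is_linear.

Section Lift.
Context (M' : lmodType R) (f : {linear M -> M'}).
Hypothesis fN0 : forall x, x \in N -> f x = 0.

Definition qlift (x : quotmod) : M' := f (qrepr x).

Lemma qlift_proj x : qlift (qproj x) = f x.
Proof. by apply/eqP; rewrite -subr_eq0 /qlift -linearB fN0 ?qrepr_proj. Qed.

Lemma qlift_is_linear : linear qlift.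
Proof.
move=> a x y; rewrite -[x]qreprK -[y]qreprK -linearP !qlift_proj.
by rewrite linearP.
Qed.

End Lift.
End Quotient.

Section Hom.
Context (R : comPzRingType) (E F : lmodType R).

Definition hom_pred : {pred E -> F} := fun f => `[< linear f >].

Fact hom_pred_submod : submod_closed hom_pred.
Proof.
split=> [|a f g].
  by apply/asboolP => b x y /=; rewrite scaler0 addr0.
rewrite !unfold_in => /asboolP lf /asboolP lg; apply/asboolP => b x y.
have E1 z : (a *: f + g) z = a *: f z + g z by [].
rewrite !E1 lf lg !scalerDr !scalerA [b * a]mulrC -!addrA.
by congr (_ + _); rewrite addrCA.
Qed.

HB.instance Definition _ := GRing.isSubmodClosed.Build R (E -> F) hom_pred
  hom_pred_submod.

(* Hom_R(E, F), with the pointwise operations. *)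
Definition Hom : lmodType R := submod hom_pred.

End Hom.

Section Kernel.
Context (R : comPzRingType) (M M' : lmodType R) (f : {linear M -> M'}).

Definition ker_pred : {pred M} := fun x => f x == 0.

Fact ker_pred_submod : submod_closed ker_pred.
Proof.
split=> [|a x y]; first by rewrite unfold_in raddf0.
by rewrite !unfold_in linearP => /eqP -> /eqP ->; rewrite scaler0 addr0.
Qed.

HB.instance Definition _ := GRing.isSubmodClosed.Build R M ker_pred
  ker_pred_submod.

Definition ker : submodClosed M := ker_pred.

End Kernel.

Section Span.
Context (R : comPzRingType) (M : lmodType R) (G : set M).

Definition span_pred : {pred M} := fun x =>
  `[< forall N : submodClosed M, (forall y, G y -> y \in N) -> x \in N >].

Fact span_pred_submod : submod_closed span_pred.
Proof.
split=> [|a x y]; first by apply/asboolP => N _; exact: rpred0.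
rewrite !unfold_in => /asboolP hx /asboolP hy; apply/asboolP => N GN.
by apply: rpredD; [apply: rpredZ; exact: hx | exact: hy].
Qed.

HB.instance Definition _ := GRing.isSubmodClosed.Build R M span_pred
  span_pred_submod.

Definition span : submodClosed M := span_pred.

End Span.

Section Free.
Context (R : comPzRingType) (X : choiceType).

Definition finsupp_pred : {pred X -> R^o} :=
  fun g => `[< finite_set [set x | g x != 0] >].

Fact finsupp_pred_submod : submod_closed finsupp_pred.
Proof.
split=> [|a g h].
  apply/asboolP; rewrite (_ : [set _ | _] = set0)%classic; first exact: finite_set0.
  by apply/seteqP; split=> x //=; rewrite eqxx.
rewrite !unfold_in => /asboolP fg /asboolP fh; apply/asboolP.
apply: (@sub_finite_set _ _ ([set x | g x != 0] `|` [set x | h x != 0])%classic).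
  move=> x /=; have [g0|] := eqVneq (g x) 0; last by left.
  have -> : (a *: g + h) x = a *: g x + h x by [].
  by rewrite g0 scaler0 add0r; right.
by rewrite finite_setU.
Qed.

HB.instance Definition _ := GRing.isSubmodClosed.Build R (X -> R^o) finsupp_pred
  finsupp_pred_submod.

(* The free module on [X]: finitely supported functions [X -> R]. *)
Definition freemod : lmodType R := submod finsupp_pred.

Fact fbasis_subproof (x : X) :
  (fun y => if y == x then 1 else 0 : R^o) \in finsupp_pred.
Proof.
apply/asboolP; apply: (@sub_finite_set _ _ [set x]%classic); last exact: finite_set1.
by move=> y /=; case: (y =P x) => // _; rewrite eqxx.
Qed.

Definition fbasis (x : X) : freemod :=
  exist (fun g => g \in finsupp_pred) _ (fbasis_subproof x).

Section Lift.
Context (M : lmodType R) (f : X -> M).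

Definition flift (g : freemod) : M := \sum_(x \in [set: X]) (val g x *: f x).

Lemma flift_seq (g : freemod) (r : seq X) : uniq r ->
  (forall x, val g x != 0 -> x \in r) -> flift g = \sum_(x <- r) val g x *: f x.
Proof.
move=> ur gr.
have zr x : x \notin r -> val g x *: f x = 0.
  by move=> xr; case: (eqVneq (val g x) 0) => [->|/gr]; rewrite ?scale0r ?(negPf xr).
rewrite fsbig_seq // /flift; apply/esym/fsbig_widen => // x [_ /= /negP].
exact: zr.
Qed.

Lemma finsupp_seq (g : freemod) : exists r : seq X, forall x, val g x != 0 -> x \in r.
Proof.
have /asboolP/finite_seqP[r gr] := valP g.
by exists r => x gx; have : [set x | val g x != 0]%classic x by []; rewrite gr.
Qed.

Lemma flift_is_linear : linear flift.
Proof.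
move=> a g h; have [[r gr] [s hs]] := (finsupp_seq g, finsupp_seq h).
pose t := undup (r ++ s); have ut : uniq t by exact: undup_uniq.
have gt x : val g x != 0 -> x \in t by move/gr; rewrite mem_undup mem_cat => ->.
have ht x : val h x != 0 -> x \in t.
  by move/hs; rewrite mem_undup mem_cat orbC => ->.
rewrite (flift_seq ut gt) (flift_seq ut ht) (flift_seq ut); last first.
  move=> x; apply: contraR => xt; change (a * val g x + val h x == 0).
  have /eqP -> : val g x == 0 by apply: contraR xt; exact: gt.
  have /eqP -> : val h x == 0 by apply: contraR xt; exact: ht.
  by rewrite mulr0 addr0.
rewrite scaler_sumr -big_split /=; apply: eq_bigr => x _.
rewrite scalerA -scalerDl; congr (_ *: _).
Qed.

HB.instance Definition _ :=
  GRing.isLinear.Build R freemod M *:%R flift flift_is_linear.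

Lemma flift_basis x : flift (fbasis x) = f x.
Proof.
rewrite (@flift_seq _ [:: x]) //; first by rewrite big_seq1 /= eqxx scale1r.
by move=> y /=; rewrite inE; case: (y =P x) => //=; rewrite eqxx.
Qed.

End Lift.
End Free.

Section Tensor.
Context (R : comPzRingType).

Section Def.
Context (A M : lmodType R).

Let e (a : A) (m : M) : freemod R (A * M)%type := fbasis R (a, m).

Definition tensor_relators : set (freemod R (A * M)%type) := fun t =>
  [\/ exists a a' m, t = e (a + a') m - e a m - e a' m,
      exists a m m', t = e a (m + m') - e a m - e a m',
      exists r a m, t = e (r *: a) m - r *: e a m |
      exists r a m, t = e a (r *: m) - r *: e a m].

Definition tensor : lmodType R := quotmod (span tensor_relators).

Definition tens (a : A) (m : M) : tensor := qproj _ (e a m).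

Lemma relator_in t : tensor_relators t -> qproj (span tensor_relators) t = 0.
Proof.
move=> rt; rewrite -(raddf0 (qproj (span tensor_relators))).
by apply/qprojP; rewrite subr0; apply/asboolP => N; apply.
Qed.

Lemma tensDl a a' m : tens (a + a') m = tens a m + tens a' m.
Proof.
have /relator_in : tensor_relators (e (a + a') m - e a m - e a' m).
  by constructor 1; exists a, a', m.
by rewrite !linearB /= -addrA -opprD => /subr0_eq.
Qed.

Lemma tensDr a m m' : tens a (m + m') = tens a m + tens a m'.
Proof.
have /relator_in : tensor_relators (e a (m + m') - e a m - e a m').
  by constructor 2; exists a, m, m'.
by rewrite !linearB /= -addrA -opprD => /subr0_eq.
Qed.

Lemma tensZl r a m : tens (r *: a) m = r *: tens a m.
Proof.
have /relator_in : tensor_relators (e (r *: a) m - r *: e a m).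
  by constructor 3; exists r, a, m.
by rewrite linearB linearZ /= => /subr0_eq.
Qed.

Lemma tensZr r a m : tens a (r *: m) = r *: tens a m.
Proof.
have /relator_in : tensor_relators (e a (r *: m) - r *: e a m).
  by constructor 4; exists r, a, m.
by rewrite linearB linearZ /= => /subr0_eq.
Qed.

End Def.

Section Map.
Context (A B M : lmodType R) (u : {linear A -> B}).

Definition tensor_map_free : {linear freemod R (A * M)%type -> tensor B M} :=
  flift (fun am => tens (u am.1) am.2).

Lemma tensor_map_freeE a m :
  tensor_map_free (fbasis R (a, m)) = tens (u a) m.
Proof. exact: flift_basis. Qed.

Lemma tensor_map_free0 t :
  t \in span (@tensor_relators A M) -> tensor_map_free t = 0.
Proof.
move=> /asboolP/(_ (ker tensor_map_free)) h; apply/eqP; apply: h => {}t.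
rewrite unfold_in => -[] [x [y [z ->]]].
- rewrite !linearB /= !tensor_map_freeE raddfD tensDl.
  by rewrite -addrA -opprD subr_eq0.
- by rewrite !linearB /= !tensor_map_freeE tensDr -addrA -opprD subr_eq0.
- by rewrite linearB linearZ /= !tensor_map_freeE linearZ tensZl subr_eq0.
- by rewrite linearB linearZ /= !tensor_map_freeE tensZr subr_eq0.
Qed.

Definition tensor_map : tensor A M -> tensor B M := qlift tensor_map_free.

Lemma tensor_mapE a m : tensor_map (tens a m) = tens (u a) m.
Proof.
rewrite /tensor_map /tens (qlift_proj tensor_map_free0).
exact: tensor_map_freeE.
Qed.

Lemma tensor_map_is_linear : linear tensor_map.
Proof. by apply: qlift_is_linear; exact: tensor_map_free0. Qed.

End Map.
End Tensor.

Section Ext.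
Context (R : comPzRingType) (F E : lmodType R).

(* The free presentation 0 -> K -> R^(F) -> F -> 0. *)
Definition ext_proj : {linear freemod R F -> F} := flift (@id F).
Definition ext_ker : lmodType R := submod (ker ext_proj).

Definition ext_restr_pred : {pred Hom ext_ker E} := fun h =>
  `[< exists g : Hom (freemod R F) E, forall k : ext_ker, val h k = val g (val k) >].

Fact ext_restr_submod : submod_closed ext_restr_pred.
Proof.
split=> [|a h h']; first by apply/asboolP; exists 0.
rewrite !unfold_in => /asboolP[g hg] /asboolP[g' hg']; apply/asboolP.
exists (a *: g + g') => k.
have -> : val (a *: h + h') k = a *: val h k + val h' k by [].
by rewrite hg hg'.
Qed.

HB.instance Definition _ := GRing.isSubmodClosed.Build R (Hom ext_ker E)
  ext_restr_pred ext_restr_submod.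

(* Ext^1_R(F, E), as the cokernel of Hom(R^(F), E) -> Hom(K, E). *)
Definition Ext1 : lmodType R := quotmod ext_restr_pred.

End Ext.

Section Localization.
Context (R : comPzRingType) (S : mulrClosed R).

Definition denom : Type := {s : R | s \in S}.

HB.instance Definition _ := SubChoice.copy denom {s : R | s \in S}.

Definition denom1 : denom := exist (fun s => s \in S) 1 (rpred1 S).

Definition denomM (s t : denom) : denom :=
  exist (fun s => s \in S) (sval s * sval t) (rpredM (svalP s) (svalP t)).

Section Module.
Context (G : lmodType R).
Implicit Types (m n : G) (s t : denom).

Definition loc_rel : rel (G * denom) := fun x y =>
  `[< exists2 u, u \in S & (u * sval y.2) *: x.1 = (u * sval x.2) *: y.1 >].

Lemma loc_rel_refl : reflexive loc_rel.
Proof. by move=> x; apply/asboolP; exists 1; rewrite ?rpred1. Qed.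

Lemma loc_rel_sym : symmetric loc_rel.
Proof.
have H x y : loc_rel x y -> loc_rel y x.
  by move=> /asboolP[u uS e]; apply/asboolP; exists u.
by move=> x y; apply/idP/idP; apply: H.
Qed.

Lemma loc_rel_trans : transitive loc_rel.
Proof.
move=> [n t] [m s] [p v] /asboolP[u uS /= e] /asboolP[w wS /= e'].
apply/asboolP; exists (u * w * sval t); first by rewrite !rpredM ?(svalP t).
move: e => /(congr1 (fun z => (w * sval v) *: z)); rewrite !scalerA /= => e.
move: e' => /(congr1 (fun z => (u * sval s) *: z)); rewrite !scalerA /= => e'.
have -> : u * w * sval t * sval v = w * sval v * (u * sval t) by ring.
have -> : u * w * sval t * sval s = u * sval s * (w * sval t) by ring.
by rewrite e -e'; congr (_ *: _); ring.
Qed.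

Definition loc_equiv := EquivRel loc_rel loc_rel_refl loc_rel_sym loc_rel_trans.

Definition locmod : Type := {eq_quot loc_equiv}.

HB.instance Definition _ := Choice.copy locmod {eq_quot loc_equiv}.

Definition frac m s : locmod := \pi_({eq_quot loc_equiv}) (m, s).
Definition loc_num (x : locmod) : G := (repr (x : {eq_quot loc_equiv})).1.
Definition loc_den (x : locmod) : denom := (repr (x : {eq_quot loc_equiv})).2.

Lemma fracK (x : locmod) : frac (loc_num x) (loc_den x) = x.
Proof. by rewrite /frac /loc_num /loc_den -surjective_pairing reprK. Qed.

Lemma fracP m s n t : frac m s = frac n t <->
  exists2 u, u \in S & (u * sval t) *: m = (u * sval s) *: n.
Proof. by split=> [/eqmodP/asboolP|h] //; apply/eqmodP/asboolP. Qed.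

Lemma locW (P : locmod -> Prop) : (forall m s, P (frac m s)) -> forall x, P x.
Proof. by move=> h x; rewrite -(fracK x). Qed.

Definition loc_add (x y : locmod) : locmod :=
  locked (frac (sval (loc_den y) *: loc_num x + sval (loc_den x) *: loc_num y)
               (denomM (loc_den x) (loc_den y))).

Definition loc_opp (x : locmod) : locmod :=
  locked (frac (- loc_num x) (loc_den x)).

Lemma loc_addE m s n t :
  loc_add (frac m s) (frac n t) = frac (sval t *: m + sval s *: n) (denomM s t).
Proof.
rewrite /loc_add -lock; move: (fracK (frac m s)) (fracK (frac n t)).
move: (loc_num (frac m s)) (loc_den (frac m s)) => m' s'.
move: (loc_num (frac n t)) (loc_den (frac n t)) => n' t'.
case/fracP => u uS e /fracP[w wS e']; apply/fracP => /=.
exists (u * w); first exact: rpredM.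
rewrite !scalerDr !scalerA.
have {}e c : (c * (u * sval s)) *: m' = (c * (u * sval s')) *: m.
  by rewrite -scalerA e scalerA.
have {}e' c : (c * (w * sval t)) *: n' = (c * (w * sval t')) *: n.
  by rewrite -scalerA e' scalerA.
congr (_ + _).
  transitivity ((w * sval t * sval t' * (u * sval s)) *: m'); first by congr (_ *: _); ring.
  by rewrite e; congr (_ *: _); ring.
transitivity ((u * sval s * sval s' * (w * sval t)) *: n'); first by congr (_ *: _); ring.
by rewrite e'; congr (_ *: _); ring.
Qed.

Lemma loc_oppE m s : loc_opp (frac m s) = frac (- m) s.
Proof.
rewrite /loc_opp -lock; move: (fracK (frac m s)).
move: (loc_num _) (loc_den _) => m' s' /fracP[u uS e].
by apply/fracP; exists u; rewrite // !scalerN e.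
Qed.

Lemma loc_addA : associative loc_add.
Proof.
elim/locW => m s; elim/locW => n t; elim/locW => p v; rewrite !loc_addE.
apply/fracP; exists 1; rewrite ?rpred1 //= !scalerDr !scalerA -addrA.
by congr (_ + (_ + _)); congr (_ *: _); ring.
Qed.

Lemma loc_addC : commutative loc_add.
Proof.
elim/locW => m s; elim/locW => n t; rewrite !loc_addE addrC.
by apply/fracP; exists 1; rewrite ?rpred1 //= [sval t * _]mulrC.
Qed.

Lemma loc_add0 : left_id (frac 0 denom1) loc_add.
Proof.
elim/locW => m s; rewrite loc_addE; apply/fracP; exists 1; rewrite ?rpred1 //=.
by rewrite scaler0 add0r scale1r !mul1r.
Qed.

Lemma loc_addN : left_inverse (frac 0 denom1) loc_opp loc_add.
Proof.
elim/locW => m s; rewrite loc_oppE loc_addE; apply/fracP; exists 1.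
  by rewrite ?rpred1.
by rewrite scalerN addNr !scaler0.
Qed.

HB.instance Definition _ :=
  GRing.isZmodule.Build locmod loc_addA loc_addC loc_add0 loc_addN.

Lemma fracD m s n t :
  frac m s + frac n t = frac (sval t *: m + sval s *: n) (denomM s t).
Proof. exact: loc_addE. Qed.

Lemma frac_same m n s : frac m s + frac n s = frac (m + n) s.
Proof.
rewrite fracD; apply/fracP; exists 1; rewrite ?rpred1 //=.
by rewrite -scalerDr !scalerA; congr (_ *: _); ring.
Qed.

End Module.

Section Action.
Context (G : lmodType R).

Definition loc_act (a : locmod R^o) (x : locmod G) : locmod G :=
  locked (frac ((loc_num a : R) *: loc_num x) (denomM (loc_den a) (loc_den x))).

Lemma loc_actE (r : R^o) s (m : G) t :
  loc_act (frac r s) (frac m t) = frac ((r : R) *: m) (denomM s t).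
Proof.
rewrite /loc_act -lock; move: (fracK (frac r s)) (fracK (frac m t)).
move: (loc_num (frac r s)) (loc_den (frac r s)) => r' s'.
move: (loc_num (frac m t)) (loc_den (frac m t)) => m' t'.
case/fracP => u uS e /fracP[w wS e']; apply/fracP => /=.
exists (u * w); first exact: rpredM.
rewrite !scalerA.
have {}e : u * sval s * r' = u * sval s' * r by exact: e.
transitivity ((u * sval s * r') *: ((w * sval t) *: m')).
  by rewrite scalerA; congr (_ *: _); ring.
by rewrite e' scalerA e; congr (_ *: _); ring.
Qed.

End Action.

(* The additive group of S^-1 R is S^-1 M for M = R^o; multiplication is the
   action of fractions of [R] on fractions of [M] for this [M]. *)
Definition locring : Type := locmod R^o.

HB.instance Definition _ := GRing.Zmodule.on locring.

Definition loc_one : locring := frac (1 : R^o) denom1.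
Definition loc_mul : locring -> locring -> locring := @loc_act R^o.

Lemma loc_mulE (a b : R^o) s t :
  loc_mul (frac a s) (frac b t) = frac ((a : R) * b : R^o) (denomM s t).
Proof. exact: loc_actE. Qed.

Lemma loc_mulA : associative loc_mul.
Proof.
elim/locW => a s; elim/locW => b t; elim/locW => c v; rewrite !loc_mulE.
apply/fracP; exists 1; rewrite ?rpred1 //=.
by congr (_ * _ *: _); [rewrite mulrA | exact: mulrA].
Qed.

Lemma loc_mulC : commutative loc_mul.
Proof.
elim/locW => a s; elim/locW => b t; rewrite !loc_mulE.
apply/fracP; exists 1; rewrite ?rpred1 //=.
by rewrite /GRing.scale /= ![1 * _]mul1r [sval t * _]mulrC [b * a]mulrC.
Qed.

Lemma loc_mul1 : left_id loc_one loc_mul.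
Proof.
elim/locW => a s; rewrite loc_mulE.
by apply/fracP; exists 1; rewrite ?rpred1 //= !mul1r.
Qed.

Lemma loc_mulDl : left_distributive loc_mul +%R.
Proof.
elim/locW => a s; elim/locW => b t; elim/locW => c v.
rewrite !(loc_mulE, fracD); apply/fracP; exists 1; rewrite ?rpred1 //=.
rewrite /GRing.scale /=; ring.
Qed.

HB.instance Definition _ :=
  GRing.Zmodule_isComPzRing.Build locring loc_mulA loc_mulC loc_mul1 loc_mulDl.

Lemma fracM (a b : R) s t :
  (frac (a : R^o) s : locring) * frac (b : R^o) t
    = frac (a * b : R^o) (denomM s t).
Proof. exact: loc_mulE. Qed.

Section ModuleStructure.
Context (G : lmodType R).

Lemma loc_actA (a b : locring) (x : locmod G) :
  loc_act a (loc_act b x) = loc_act (a * b) x.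
Proof.
elim/locW: a => a s; elim/locW: b => b t; elim/locW: x => m v.
rewrite -[_ * _]/(loc_mul _ _) loc_mulE !loc_actE scalerA.
apply/fracP; exists 1; rewrite ?rpred1 //=.
by congr (_ * _ *: _); rewrite mulrA.
Qed.

Lemma loc_act1 : left_id (1 : locring) (@loc_act G).
Proof.
elim/locW => m s; rewrite loc_actE.
by apply/fracP; exists 1; rewrite ?rpred1 //= !mul1r scale1r.
Qed.

Lemma loc_actDr : right_distributive (@loc_act G) +%R.
Proof.
elim/locW => a s; elim/locW => m t; elim/locW => n v.
rewrite !(loc_actE, fracD); apply/fracP; exists 1; rewrite ?rpred1 //=.
rewrite !scalerDr !scalerA; congr (_ + _); congr (_ *: _); ring.
Qed.

Lemma loc_actDl (x : locmod G) : {morph (@loc_act G)^~ x : a b / a + b}.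
Proof.
elim/locW: x => m v; elim/locW => a s; elim/locW => b t /=.
rewrite !(loc_actE, fracD); apply/fracP; exists 1; rewrite ?rpred1 //=.
rewrite !scalerDl !scalerDr !scalerA -!scalerDl; congr (_ *: _).
rewrite /GRing.scale /=; ring.
Qed.

HB.instance Definition _ := GRing.Zmodule_isLmodule.Build locring (locmod G)
  loc_actA loc_act1 loc_actDr loc_actDl.

Lemma fracZ (r : R) s (m : G) t :
  (frac (r : R^o) s : locring) *: frac m t = frac (r *: m) (denomM s t).
Proof. exact: loc_actE. Qed.

End ModuleStructure.
End Localization.

Section MaximalIdeal.
Context (R : comPzRingType).

Definition maximal_ideal (P : submodClosed R^o) : Prop :=
  1 \notin P /\
  forall J : submodClosed R^o,
    1 \notin J -> {subset P <= J} -> {subset J <= P}.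

Record maxIdeal := MaxIdeal {
  maxi_ideal :> submodClosed R^o;
  maxi_maximal : maximal_ideal maxi_ideal
}.

Definition maxi_compl (P : maxIdeal) : {pred R} := fun x => x \notin maxi_ideal P.

Fact maxi_compl_mulr (P : maxIdeal) : mulr_closed (maxi_compl P).
Proof.
have [P1 Pmax] := maxi_maximal P; split=> // a b aP bP.
change ((a * b : R^o) \notin maxi_ideal P); apply/negP => abP.
have /negP := aP : (a : R^o) \notin maxi_ideal P; apply.
pose J : {pred R^o} := fun x => `[< exists p c, p \in maxi_ideal P /\ x = p + c * a >].
have JP : submod_closed J.
  split=> [|r x y]; first by apply/asboolP; exists 0, 0; rewrite rpred0 mul0r addr0.
  move=> /asboolP[p [c [pP ->]]] /asboolP[q [d [qP ->]]]; apply/asboolP.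
  exists (r *: p + q), (r * c + d); split; first by rewrite rpredD ?rpredZ.
  rewrite scalerDr mulrDl addrACA; congr (_ + (_ + _)).
  by rewrite /GRing.scale /= mulrA.
pose JC := GRing.isSubmodClosed.Build R R^o J JP.
pose J' : submodClosed R^o := HB.pack_for (submodClosed R^o) J JC.
have aJ : a \in J' by apply/asboolP; exists 0, 1; rewrite rpred0 add0r mul1r.
apply: (Pmax J' _ _ a aJ).
  apply/negP => /asboolP[p [c [pP e]]]; have /negP := bP : (b : R^o) \notin maxi_ideal P; apply.
  have -> : b = b * p + c * (a * b) by rewrite -[LHS]mulr1 e; ring.
  by exact: rpredD (rpredZ b pP) (rpredZ c abP).
by move=> x xP; apply/asboolP; exists x, 0; rewrite mul0r addr0.
Qed.

HB.instance Definition _ (P : maxIdeal) :=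
  GRing.isMulClosed.Build R (maxi_compl P) (maxi_compl_mulr P).

Definition loc_at (P : maxIdeal) : comPzRingType := locring (maxi_compl P).

End MaximalIdeal.

Section ModuleNotions.
Context (R : comPzRingType).
Implicit Types (M E F L : lmodType R).

Definition fin_gen M : Prop :=
  exists (n : nat) (g : 'I_n -> M),
    forall x, exists c : 'I_n -> R, x = \sum_(i < n) c i *: g i.

Definition fin_pres M : Prop :=
  exists (n : nat) (p : {linear 'rV[R]_n -> M}),
    (forall x, exists v, p v = x) /\ fin_gen (submod (ker p)).

Definition uniserial M : Prop :=
  forall N N' : submodClosed M, {subset N <= N'} \/ {subset N' <= N}.

Definition injective_module E : Prop :=
  forall (B : lmodType R) (A : submodClosed B) (f : {linear submod A -> E}),
    exists g : {linear B -> E}, forall a : submod A, g (val a) = f a.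

Definition finitely_injective M : Prop :=
  forall (B : lmodType R) (A : submodClosed B), fin_gen (submod A) ->
  forall f : {linear submod A -> M},
    exists g : {linear B -> M}, forall a : submod A, g (val a) = f a.

Definition FP_injective E : Prop :=
  forall F, fin_pres F -> forall x : Ext1 F E, x = 0.

Definition flat M : Prop :=
  forall (A B : lmodType R) (u : {linear A -> B}),
    injective u -> injective (@tensor_map R A B M u).

Definition indecomposable M : Prop :=
  (exists x : M, x != 0) /\
  forall A B : submodClosed M,
    (forall x, exists a b, [/\ a \in A, b \in B & x = a + b]) ->
    (forall x, x \in A -> x \in B -> x = 0) ->
    (forall x, x \in A -> x = 0) \/ (forall x, x \in B -> x = 0).

(* Internal direct sum. *)
Definition direct_sum M n (N : 'I_n -> submodClosed M) : Prop :=
  (forall x, exists2 e : 'I_n -> M,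
     (forall i, e i \in N i) & x = \sum_(i < n) e i) /\
  (forall e : 'I_n -> M, (forall i, e i \in N i) ->
     \sum_(i < n) e i = 0 -> forall i, e i = 0).

(* An injective hull is an essential embedding into an injective module: the
   last clause says that a submodule meeting the image of [j] trivially is 0. *)
Definition injective_hull M E (j : {linear M -> E}) : Prop :=
  [/\ injective_module E, injective j &
      forall N : submodClosed E,
        (forall m, j m \in N -> j m = 0) -> forall x, x \in N -> x = 0].

Definition goldie_dim M (n : nat) : Prop :=
  exists E (j : {linear M -> E}), injective_hull j /\
    exists N : 'I_n -> submodClosed E, direct_sum N /\
      forall i, injective_module (submod (N i)) /\ indecomposable (submod (N i)).

Definition finite_goldie_dim M : Prop := exists n, goldie_dim M n.

End ModuleNotions.

Section RingNotions.
Implicit Type R : comPzRingType.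

Definition valuation_ring R : Prop := uniserial (R^o : lmodType R).

Definition arithmetical R : Prop :=
  forall P : maxIdeal R, valuation_ring (loc_at P).

Definition coherent R : Prop :=
  forall I : submodClosed (R^o : lmodType R),
    fin_gen (submod I) -> fin_pres (submod I).

Definition semicoherent R : Prop :=
  forall E F : lmodType R, injective_module E -> injective_module F ->
    exists L : lmodType R, flat L /\
      exists i : {linear Hom E F -> L}, injective i.

End RingNotions.

(* Main.v *)
(** Localizing an injective module [E] at [S] over a valuation ring [V]: let [J]
    be the set of elements of which no multiple lies in [S]. Every element of
    [S] divides every element of [J], so [J] kills the [S]-torsion of [E]. A map
    [f] from an ideal [A] of the localization to [S^-1 E] is lifted, up to one
    [t] in [S], to a map into [E] by [j a' |-> t j e'], with [j] in [J] and [e']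
    representing [f a'] (when [A = J A]; otherwise [A] is principal). The lift is
    well defined as soon as [t ann(a) e = 0] whenever [e] represents [f a]. Such
    a [t] always exists when [S] contains zero divisors; otherwise [t = 1] works
    because the ideal of zero divisors is flat over the total ring of fractions
    [Q], or there are no regular nonunits among the denominators. The remaining
    case, [Q] coherent and [V] not, makes [V] semicoherent: there annihilators in
    [Q] are principal, so that [Hom_V(Q, F)] is flat for [F] injective, and
    [Hom_V(E, F)] embeds in a power of it since [E] is a quotient of a power of
    [Q].

    An indecomposable injective module over an arithmetical ring is uniform,
    hence a module over some [R_P], and condition (b) embeds every finitely
    generated module in a finite direct sum of such modules. As (finite and FP-)
    injectivity only involve finitely generated submodules, they localize.

    If [R_P] is coherent then [ann(a)_P] is generated by some [s]; dividing the
    image of [1] by [a] in the localized hull of [R / sR] yields a single [u]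
    outside [P] with [u ann(a)] inside [sR]. Thus a relation module is finitely
    generated up to a multiplier outside each maximal ideal, and these
    multipliers generate the unit ideal. *)
From HB Require Import structures.
From mathcomp Require Import all_boot all_algebra.
From mathcomp Require Import ring.
From mathcomp Require Import boolp classical_sets functions.
Require Import Defs.

Set Implicit Arguments.
Unset Strict Implicit.
Unset Printing Implicit Defensive.

Import GRing.Theory.

Local Open Scope ring_scope.

(** * Maximal submodules, graphs and Baer's criterion *)

Section Submodules.
Context (R : comPzRingType) (M : lmodType R).

(** Submodules as [Prop]-valued sets, which suit Zorn's lemma and set comprehension; [submod_of]
    bundles one when needed. *)
Definition closed_under_lin (A : set M) : Prop :=
  A 0 /\ forall a x y, A x -> A y -> A (a *: x + y).

Section Pack.
Context (A : set M) (clA : closed_under_lin A).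

Definition set_pred : {pred M} := fun x => `[< A x >].

Fact set_pred_submod : submod_closed set_pred.
Proof.
have [A0 AD] := clA; split; first exact/asboolP.
by move=> a x y /asboolP xA /asboolP yA; apply/asboolP/AD.
Qed.

Definition submod_of : submodClosed M :=
  let c := GRing.isSubmodClosed.Build R M set_pred set_pred_submod in
  HB.pack_for (submodClosed M) set_pred c.

Lemma submod_ofP x : reflect (A x) (x \in submod_of).
Proof. exact: asboolP. Qed.

End Pack.

Lemma closed_addr (A : set M) x y : closed_under_lin A -> A x -> A y -> A (x + y).
Proof. by move=> [_ AD] xA yA; rewrite -[x]scale1r; apply: AD. Qed.

Lemma closed_scaler (A : set M) a x : closed_under_lin A -> A x -> A (a *: x).
Proof. by move=> [A0 AD] xA; rewrite -[_ *: _]addr0; apply: AD. Qed.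

Lemma closed_oppr (A : set M) x : closed_under_lin A -> A x -> A (- x).
Proof. by move=> clA xA; rewrite -scaleN1r; apply: closed_scaler. Qed.

Lemma closed_subr (A : set M) x y : closed_under_lin A -> A x -> A y -> A (x - y).
Proof. by move=> clA xA yA; apply: closed_addr => //; apply: closed_oppr. Qed.

Lemma closed_sum (A : set M) (I : Type) (r : seq I) (P : pred I) (F : I -> M) :
  closed_under_lin A -> (forall i, P i -> A (F i)) -> A (\sum_(i <- r | P i) F i).
Proof.
move=> clA FA; elim/big_ind: _ => //; first by case: clA.
by move=> x y; apply: closed_addr.
Qed.

Lemma submod_closed_under_lin (N : submodClosed M) :
  closed_under_lin (fun x : M => x \in N).
Proof. by split=> [|a x y xN yN] /=; [exact: rpred0 | rewrite rpredD ?rpredZ]. Qed.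

(** Zorn's lemma in the form used throughout: X = {1} gives maximal ideals, the nonzero elements of
    a submodule give relative complements, and the nonzero vertical vectors give maximal partial
    linear maps. *)
Lemma submod_maximal_avoiding (A X : set M) : closed_under_lin A ->
  (forall x, A x -> ~ X x) ->
  exists C : set M, [/\ closed_under_lin C, A `<=` C, forall x, C x -> ~ X x &
    forall D : set M, closed_under_lin D -> C `<=` D ->
      (forall x, D x -> ~ X x) -> D `<=` C]%classic.
Proof.
move=> clA AX.
(* The empty set is admitted so that the union of the empty chain qualifies. *)
pose Q (C : set M) := C = set0 \/
  [/\ closed_under_lin C, A `<=` C & forall x, C x -> ~ X x]%classic.
have [F FQ Ftot|C [QC maxC]] := @Zorn_bigcup M Q.
  have [[C0 [FC0 C0n]]|Fn] := pselect (exists C, F C /\ C <> set0%classic); last first.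
    left; apply/seteqP; split=> // x [C FC Cx].
    by apply: Fn; exists C; split=> // C0; rewrite C0 in Cx.
  have goodF C : F C -> C <> set0%classic ->
      [/\ closed_under_lin C, A `<=` C & forall x, C x -> ~ X x]%classic.
    by move=> FC Cn; have [] := FQ _ FC.
  have inF C x : F C -> C x -> [/\ closed_under_lin C, A `<=` C & forall x, C x -> ~ X x]%classic.
    by move=> FC Cx; apply: goodF => // C0'; rewrite C0' in Cx.
  have [clC0 AC0 C0X] := goodF _ FC0 C0n.
  right; split; first split; first by exists C0 => //; case: clC0.
  - move=> a x y [C FC Cx] [D FD Dy].
    have [CD|DC] := Ftot C D FC FD.
      by exists D => //; have [[_ clD] _ _] := inF _ _ FD Dy; apply: clD => //; exact: CD.
    by exists C => //; have [[_ clC] _ _] := inF _ _ FC Cx; apply: clC => //; exact: DC.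
  - by move=> x Ax; exists C0 => //; exact: AC0.
  - by move=> x [C FC Cx]; have [_ _ CX] := inF _ _ FC Cx; exact: CX.
have QA : Q A by right; split.
have Cn : C <> set0%classic.
  move=> C0; apply: (maxC A) => //; rewrite C0; split=> [x []|h].
  exact: (h 0 (proj1 clA)).
case: QC => // -[clC AC CX]; exists C; split=> // D clD CD DX x Dx.
apply: contrapT => nCx; apply: (maxC D).
  by split=> // DC; apply: nCx; exact: DC.
by right; split=> // y /AC/CD.
Qed.

End Submodules.

Section LinearOf.
Context (R : comPzRingType) (M M' : lmodType R).

Definition linear_of (f : M -> M') (lf : linear f) : {linear M -> M'} :=
  let c := GRing.isLinear.Build R M M' *:%R f lf in
  HB.pack_for {linear M -> M'} f c.

Lemma linear_ofE f (lf : linear f) x : linear_of lf x = f x.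
Proof. by []. Qed.

End LinearOf.

(* Partial linear maps are handled through their graphs. *)
Definition functional_graph (R : comPzRingType) (B E : lmodType R)
    (G : set (B * E)%type) : Prop :=
  closed_under_lin G /\ forall y, G (0, y) -> y = 0.

Lemma functional_graph_inj (R : comPzRingType) (B E : lmodType R)
    (G : set (B * E)%type) x y z :
  functional_graph G -> G (x, y) -> G (x, z) -> y = z.
Proof.
move=> [clG G0] xy xz; apply/subr0_eq/G0.
by rewrite -[0](subrr x); exact: (closed_subr clG xy xz).
Qed.

Lemma functional_graph_map (R : comPzRingType) (B E : lmodType R)
    (G : set (B * E)%type) : functional_graph G ->
  exists (A : submodClosed B) (f : {linear submod A -> E}),
    (forall x, x \in A <-> exists y, G (x, y)) /\
    forall (a : submod A) y, G (val a, y) -> f a = y.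
Proof.
move=> fG; have [clG _] := fG.
pose D : set B := fun x => exists y, G (x, y).
have clD : closed_under_lin D.
  split=> [|a x y [x' xx'] [y' yy']]; first by exists 0; case: clG.
  by exists (a *: x' + y'); exact: (proj2 clG a _ _ xx' yy').
pose A := submod_of clD.
have /choice[f fP] (a : submod A) : exists y, G (val a, y).
  by apply/(submod_ofP clD)/valP.
have lf : linear f.
  move=> a x y; apply: (functional_graph_inj fG (fP _)).
  exact: (proj2 clG _ _ _ (fP x) (fP y)).
exists A, (linear_of lf); split=> [x|a y ay].
  by split=> [/(submod_ofP clD)|h]; last exact/(submod_ofP clD).
exact: (functional_graph_inj fG (fP _)).
Qed.

Section Baer.
Context (R : comPzRingType) (E : lmodType R).

Lemma injective_extends_graph : injective_module E ->
  forall (B : lmodType R) (G : set (B * E)%type), functional_graph G ->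
  exists g : {linear B -> E}, forall x y, G (x, y) -> g x = y.
Proof.
move=> injE B G /functional_graph_map[A [f [AP fP]]].
have [g gP] := injE B A f; exists g => x y xy.
have xA : x \in A by apply/AP; exists y.
by rewrite -(fP (exist _ x xA) y xy) -gP.
Qed.

(** Here [G] is the graph of a map from an ideal, and [y] is the value at 1 of an extension to the
    whole ring. *)
Definition baer : Prop :=
  forall G : set (R^o * E)%type, functional_graph G ->
  exists y, forall r x, G (r, x) -> x = (r : R) *: y.

Lemma injective_baer : injective_module E -> baer.
Proof.
move=> injE G fG; have [g gP] := injective_extends_graph injE fG.
by exists (g 1) => r x /gP <-; rewrite -linearZ /= /GRing.scale /= mulr1.
Qed.

(** A maximal graph extending that of [f] is total, since any [b] can be adjoined to its domain. *)
Lemma baer_injective : baer -> injective_module E.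
Proof.
move=> bE B A f.
pose G0 : set (B * E)%type :=
  fun z => exists2 a : submod A, val a = z.1 & f a = z.2.
have clG0 : closed_under_lin G0.
  split; first by exists 0; rewrite ?raddf0.
  move=> a x y [u ux fu] [v vy fv]; exists (a *: u + v) => /=.
    by rewrite -ux -vy.
  by rewrite linearP fu fv.
pose X : set (B * E)%type :=
  fun z => z.1 = 0 /\ z.2 != 0.
have [|G [clG G0G GX maxG]] := @submod_maximal_avoiding R _ G0 X clG0.
  move=> [x y] [a /= ax fa] [/= x0 /negP]; apply; rewrite -fa.
  by have -> : a = 0 by [apply: val_inj; rewrite /= ax]; rewrite raddf0.
have G_inj y : G (0, y) -> y = 0.
  by move=> Gy; apply: contrapT => /eqP y0; apply: (GX _ Gy).
have fG : functional_graph G by [].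
have total b : exists y, G (b, y).
  (* The map r |-> G(r b), on the ideal of those r with r b in the domain of [G]. *)
  pose H : set (R^o * E)%type :=
  fun z => G ((z.1 : R) *: b, z.2).
  have [|y yP] := bE H.
    split; first split.
    - by rewrite /H /= scale0r; case: clG.
    - move=> a [r x] [r' x']; rewrite /H /= => h h'.
      by rewrite scalerDl -scalerA; exact: (proj2 clG _ _ _ h h').
    - by move=> y; rewrite /H /= scale0r; exact: G_inj.
  exists y.
  (* The extension of [G] that sends [b] to [y]; maximality puts it inside [G]. *)
  pose G' : set (B * E)%type :=
  fun z => exists r : R, G (z.1 - r *: b, z.2 - r *: y).
  have := maxG G'; apply.
  - split; first by exists 0; rewrite /= !scale0r !subr0; case: clG.
    move=> a [x1 x2] [y1 y2] [r /= h] [r' /= h']; exists (a * r + r').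
    have e (V : lmodType R) (u v w : V) :
        a *: u + v - (a * r + r') *: w = a *: (u - r *: w) + (v - r' *: w).
      by rewrite scalerDl -scalerA scalerBr opprD addrACA.
    change (G (a *: x1 + y1 - (a * r + r') *: b, a *: x2 + y2 - (a * r + r') *: y)).
    rewrite !e; exact: (proj2 clG a _ _ h h').
  - by move=> [x1 x2] /= h; exists 0; rewrite /= !scale0r !subr0.
  - move=> [x1 x2] [r /= h] [/= x10 /negP]; apply; apply/eqP.
    move: h; rewrite x10 sub0r -scaleNr => h.
    have /yP : H (- r, x2 - r *: y) by [].
    by rewrite scaleNr => /(canRL (subrK _)); rewrite addNr.
  - by exists 1; rewrite /= !scale1r !subrr; case: clG.
have [g gP] := choice total.
have lg : linear g.
  move=> a x y; apply: (functional_graph_inj fG (gP _)).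
  exact: (proj2 clG _ _ _ (gP x) (gP y)).
exists (linear_of lg) => a; rewrite linear_ofE.
by apply: (functional_graph_inj fG (gP _)); apply: G0G; exists a.
Qed.

End Baer.

(** * Localizing injective modules over a valuation ring *)

(** The divisibility form of [valuation_ring], used in all computations. *)
Definition chain_ring (V : comPzRingType) : Prop :=
  forall a b : V, (exists c, b = c * a) \/ (exists c, a = c * b).

Section LocalExtension.
Context (V : comPzRingType) (E : lmodType V) (S : set V).
Hypotheses (Vchain : chain_ring V) (Ebaer : baer E).
Hypotheses (S1 : S 1) (SM : forall s t, S s -> S t -> S (s * t)).

Definition tors (x : E) : Prop := exists2 s, S s & s *: x = 0.

(** [J] and [K] are the preimages in [V] of the nonunits and of zero in the localization at [S]. *)
Let J : set V := fun j => forall c, ~ S (c * j).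
Let K : set V := fun r => exists2 s, S s & s * r = 0.

Let JM c j : J j -> J (c * j).
Proof. by move=> jJ d; rewrite mulrA. Qed.

Let JD i j : J i -> J j -> J (i + j).
Proof.
move=> iJ jJ; have [[c e]|[c e]] := Vchain i j.
  by rewrite e -{1}[i]mul1r -mulrDl; apply: JM.
by rewrite e -{2}[j]mul1r -mulrDl; apply: JM.
Qed.

Let J_tors j x : J j -> tors x -> j *: x = 0.
Proof.
move=> jJ [s sS sx]; have [[c e]|[c e]] := Vchain s j.
  by rewrite e -scalerA sx scaler0.
by case: (jJ c); rewrite -e.
Qed.

Let tors_div s x : S s -> tors (s *: x) -> tors x.
Proof. by move=> sS [t tS tx]; exists (t * s); [exact: SM | rewrite -scalerA]. Qed.

Let S_nonunit a b : ~ K a -> b * a = 0 -> J b.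
Proof.
by move=> aK ba c cS; apply: aK; exists (c * b); rewrite // -mulrA ba mulr0.
Qed.

(* This is where the ideal of zero divisors of [V] is required to be flat. *)
Hypothesis regular_ann : (forall s r, S s -> s * r = 0 -> r = 0) ->
  forall (a b : V) (e : E), a != 0 -> b * a = 0 ->
    (forall c, c * a = 0 -> tors (c *: e)) -> b *: e = 0.

(** A map from an ideal of [V] that is single valued only modulo [S]-torsion: this is what a map
    into S^-1 E becomes once denominators are cleared. *)
Context (G : set (V^o * E)%type).
Hypotheses (clG : closed_under_lin G) (G0 : forall x, G (0, x) -> tors x).

Let GP r (a : V) e : G (a, e) -> G (r * a : V, r *: e).
Proof. by move=> ae; exact: (closed_scaler r clG ae). Qed.

Let GB (a : V) e e' : G (a, e) -> G (a, e') -> tors (e - e').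
Proof.
move=> h h'; apply: G0; have := closed_subr clG h h'.
by rewrite -[(a : V^o, e) - _]/(a - a : V^o, e - e') subrr.
Qed.

Let G_ann (a : V) e b : G (a, e) -> b * a = 0 -> tors (b *: e).
Proof. by move=> /(GP b) h ba; apply: G0; rewrite -ba. Qed.

(** If [K] contains k <> 0, write k = b0 a0. Then b0 e0 is torsion, and any [t] in [S] killing it
    serves all pairs: comparing [a] with [a0], the element b e is a multiple of b0 e0, for otherwise
    k would be a multiple of b a = 0. If K = 0, then t = 1 works by [regular_ann]. *)
Lemma uniform_annihilator (a0 : V) e0 : G (a0, e0) -> ~ K a0 ->
  exists2 t, S t & forall (a : V) e b, G (a, e) -> ~ K a -> b * a = 0 ->
    (t * b) *: e = 0.
Proof.
move=> G0' a0K; have [[k [kn [s sS sk]]]|Kn] := pselect (exists k, k != 0 /\ K k).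
  have [[b0 kE]|[c a0E]] := Vchain a0 k; last first.
    by case: a0K; exists s; rewrite // a0E mulrCA sk mulr0.
  have b0J : J b0.
    move=> c cS; apply: a0K; exists (s * (c * b0)); first exact: SM.
    by rewrite -!mulrA -kE mulrCA sk mulr0.
  have [t tS te] : tors (b0 *: e0).
    apply: (tors_div sS); rewrite scalerA; apply: G_ann G0' _.
    by rewrite -mulrA -kE.
  exists t => // a e b Gae aK ba.
  have bJ := S_nonunit aK ba.
  have [[c aE]|[c a0E]] := Vchain a0 a.
    have bE : b *: e = (b * c) *: e0.
      apply/subr0_eq; rewrite -scalerA -scalerBr; apply: J_tors => //.
      by apply: GB Gae _; rewrite aE; apply: GP.
    have [[d bcE]|[d b0E]] := Vchain b0 (b * c).
      by rewrite -scalerA bE bcE scalerA mulrCA -scalerA -scalerA te scaler0.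
    by move/eqP: kn; case; rewrite kE b0E -!mulrA -aE ba mulr0.
  have b0e0 : b0 *: e0 = (b0 * c) *: e.
    apply/subr0_eq; rewrite -scalerA -scalerBr; apply: J_tors => //.
    by apply: GB G0' _; rewrite a0E; apply: GP.
  have [[d bE]|[d b0cE]] := Vchain (b0 * c) b.
    by rewrite bE mulrCA -scalerA -scalerA -b0e0 te scaler0.
  by move/eqP: kn; case; rewrite kE a0E mulrA b0cE -mulrA ba mulr0.
exists 1 => // a e b Gae aK ba; rewrite mul1r.
apply: (regular_ann _ (a := a)) => //.
- move=> s r sS sr; apply: contrapT => /eqP rn; apply: Kn.
  by exists r; split=> //; exists s.
- by apply/eqP => a0'; apply: aK; exists 1; rewrite ?a0' ?mulr0.
- by move=> c; apply: G_ann.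
Qed.

Lemma extends_up_to_torsion :
  exists n s0, S s0 /\ forall (r : V) x, G (r, x) ->
    exists2 s, S s & (s * s0) *: x = (s * r) *: n.
Proof.
(* Here the localized ideal is the unit ideal, and c e / (c a) is the image of 1. *)
have [[a [e [c [Gae cS]]]]|GJ] := pselect (exists a e c, G (a, e) /\ S (c * a)).
  exists (c *: e), (c * a); split=> // r x Grx.
  have [s sS sx] : tors ((c * a) *: x - r *: (c *: e)).
    by apply: (GB (GP _ Grx)); rewrite mulrC; apply/GP/GP.
  by exists s => //; apply/subr0_eq; rewrite -!scalerA -scalerBr scalerA.
(* If the whole domain lies in [K], the localized ideal is zero and n = 0 will do. *)
have [[a0 [e0 [Gae0 a0K]]]|GK] := pselect (exists a0 e0, G (a0, e0) /\ ~ K a0); last first.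
  exists 0, 1; split=> // r x Grx.
  have [s sS sr] : K r by apply: contrapT => rK; apply: GK; exists r, x.
  have [t tS tx] : tors (s *: x) by apply: G_ann Grx _.
  by exists (t * s); [exact: SM | rewrite mulr1 -scalerA tx scaler0].
have [t tS tP] := uniform_annihilator Gae0 a0K.
(* Here [a] generates the localized ideal, and r a |-> r t e is well defined by the choice of
   [t]. *)
have [[a [e [Gae aK aP]]]|np] := pselect (exists a e, [/\ G (a, e), ~ K a &
    forall a' e', G (a', e') -> exists2 s, S s & exists c, s * a' = c * a]).
  have [|n nP] := Ebaer (G := fun z => exists r, z = (r * a : V^o, (r * t) *: e)).
    split; first split; first by exists 0; rewrite !mul0r scale0r.
      move=> r _ _ [r1 ->] [r2 ->]; exists (r * r1 + r2).
      rewrite -[LHS]/(r * (r1 * a) + r2 * a : V^o,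
        r *: ((r1 * t) *: e) + (r2 * t) *: e).
      congr (_, _); first by ring.
      by rewrite !mulrDl scalerDl -!mulrA -[in RHS]scalerA.
    by move=> y [r [/esym ra ->]]; rewrite mulrC; apply: tP Gae _ _.
  exists n, t; split=> // r x Grx; have [s sS [c sr]] := aP _ _ Grx.
  have [s1 s1S] : tors (s *: x - c *: e).
    by apply: (GB (GP _ Grx)); rewrite sr; apply: GP.
  rewrite scalerBr => /subr0_eq s1E; exists (s1 * s); first exact: SM.
  have te : t *: e = a *: n by apply: nP; exists 1; rewrite !mul1r.
  have -> : (s1 * s * t) *: x = t *: (s1 *: (s *: x)).
    by rewrite !scalerA; congr (_ *: _); ring.
  rewrite s1E; have -> : t *: (s1 *: (c *: e)) = (s1 * c) *: (t *: e).
    by rewrite !scalerA; congr (_ *: _); ring.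
  by rewrite te scalerA -!mulrA sr.
(* Without a generator, every element of the domain is a multiple, by a factor in [J], of another
   one outside [K]. *)
have npP a e : G (a, e) ->
    exists j a' e', [/\ G (a', e'), ~ K a', J j & a = j * a'].
  have main a1 e1 : G (a1, e1) -> ~ K a1 ->
      exists j a' e', [/\ G (a', e'), ~ K a', J j & a1 = j * a'].
    move=> Ga1 a1K; apply: contrapT => nj; apply: np; exists a1, e1; split=> //.
    move=> a' e' Ga'; have [[c aE]|[j aE]] := Vchain a1 a'.
      by exists 1; rewrite // mul1r; exists c.
    have [[c cS]|jJ] := pselect (exists c, S (c * j)).
      by exists (c * j) => //; exists c; rewrite aE mulrA.
    case: nj; exists j, a', e'; split=> //.
      by move=> [s sS sa]; apply: a1K; exists s; rewrite // aE mulrCA sa mulr0.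
    by move=> c cS; apply: jJ; exists c.
  move=> Gae; have [aK|aK] := pselect (K a); last exact: main Gae aK.
  have [j [a' [e' [Ga' a'K jJ a0E]]]] := main _ _ Gae0 a0K.
  have [[c aE]|[c a0E']] := Vchain a0 a.
    exists (c * j), a', e'; split=> //; first exact: JM.
    by rewrite aE a0E mulrA.
  case: aK a0K => s sS sa []; exists s => //.
  by rewrite a0E' mulrCA sa mulr0.
(* Multiplying by an element of [J] removes the torsion ambiguity. For the linearity of [H], two of
   its elements are rewritten over whichever of their base elements divides the other. *)
have Je j a' e' a1 e1 c : J j -> G (a', e') -> G (a1, e1) -> a' = c * a1 ->
    j *: e' = (j * c) *: e1.
  move=> jJ Ga' Ga1 aE; apply/subr0_eq; rewrite -scalerA -scalerBr.
  by apply: J_tors => //; apply: GB Ga' _; rewrite aE; apply: GP.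
pose H : set (V^o * E)%type := fun z => exists j a' e',
  [/\ G (a', e'), ~ K a', J j, z.1 = j * a' & z.2 = (t * j) *: e'].
have [|n nP] := Ebaer (G := H).
  split; first split.
  - exists 0, a0, e0; split=> //=; last by rewrite mulr0 scale0r.
      move=> c; rewrite mulr0 => S0; apply: a0K; exists 0 => //.
      by rewrite mul0r.
    by rewrite mul0r.
  - move=> r [_ _] [_ _] [j [a [e [Ga aK jJ /= -> ->]]]]
      [i [b [f [Gb bK iJ /= -> ->]]]].
    have [[c bE]|[c aE]] := Vchain a b.
      exists (r * j + i * c), a, e; split=> //=.
      - by apply: JD; [apply: JM | rewrite mulrC; apply: JM].
      - by rewrite bE -[_ *: _]/(r * (j * a)); ring.
      rewrite -[(t * i) *: f]scalerA (Je _ _ _ _ _ _ iJ Gb Ga bE) !scalerA -scalerDl.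
      by congr (_ *: _); ring.
    exists (r * (j * c) + i), b, f; split=> //=.
    - by apply: JD => //; apply: JM; rewrite mulrC; apply: JM.
    - by rewrite aE -[_ *: _]/(r * (j * (c * b))); ring.
    rewrite -[(t * j) *: e]scalerA (Je _ _ _ _ _ _ jJ Ga Gb aE) !scalerA -scalerDl.
    by congr (_ *: _); ring.
  - by move=> y [j [a [e [Ga aK jJ /= /esym ja ->]]]]; apply: tP Ga aK ja.
exists n, t; split=> // r x Grx.
have [j [a [e [Ga aK jJ rE]]]] := npP _ _ Grx.
have [s sS] : tors (x - j *: e) by apply: GB Grx _; rewrite rE; apply: GP.
rewrite scalerBr => /subr0_eq sx; exists s => //.
have -> : (s * r) *: n = s *: ((t * j) *: e).
  by rewrite -scalerA -(nP r ((t * j) *: e)) //; exists j, a, e.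
have -> : (s * t) *: x = t *: (s *: x) by rewrite scalerA mulrC.
by rewrite sx !scalerA; congr (_ *: _); ring.
Qed.

End LocalExtension.

(** * Semicoherent valuation rings *)

Section AnnihilatorPairs.
Context (V : comPzRingType).
Hypothesis Vchain : chain_ring V.

Definition regular (c : V) : Prop := forall x, c * x = 0 -> x = 0.

Lemma nonregular c : ~ regular c -> exists2 x, c * x = 0 & x != 0.
Proof.
move=> ncr; apply: contrapT => nx; apply: ncr => x cx.
by apply: contrapT => /eqP x0; apply: nx; exists x.
Qed.

Lemma regularM c d : regular c -> regular d -> regular (c * d).
Proof. by move=> rc rd x; rewrite -mulrA => /rc/rd. Qed.

(* Over the localization at the regular elements, [s] kills [r] and the
   annihilator of [s] is generated by [r]. *)
Definition ann_pair (r s : V) : Prop :=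
  r * s = 0 /\ forall y, s * y = 0 -> exists2 c, regular c & exists d, c * y = r * d.

(** The delicate case is s = h y with h w = 0 and w <> 0. As [s] is nonzero, w = w' y; then s w' =
    0, so up to a regular factor w' is a multiple of [r], and r y = 0 forces w = 0. *)
Lemma ann_pair_sym r s : r != 0 -> s != 0 -> ann_pair r s -> ann_pair s r.
Proof.
move=> r0 s0 [rs sP]; split; first by rewrite mulrC.
move=> y ry; have [[h yE]|[h sE]] := Vchain s y.
  by exists 1; [move=> x; rewrite mul1r | exists h; rewrite mul1r mulrC].
have [hr|/nonregular[w hw w0]] := pselect (regular h).
  by exists h => //; exists 1; rewrite mulr1.
case/eqP: w0; have [[w' wE]|[w' yE]] := Vchain y w.
  have [|c rc [d cw]] := sP w'.
    by rewrite sE -mulrA [y * _]mulrC -wE.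
  by apply: rc; rewrite wE mulrA cw mulrAC ry mul0r.
by case/eqP: s0; rewrite sE yE mulrCA hw mulr0.
Qed.

Lemma ann_pair_factor r d s : r * d != 0 -> ann_pair (r * d) s -> ann_pair r (d * s).
Proof.
move=> rd0 [rds sP]; split; first by rewrite mulrA.
move=> y dsy; have [|c rc [z cz]] := sP (d * y); first by rewrite mulrCA mulrA.
pose x := c * y - r * z.
have dx : d * x = 0 by rewrite /x mulrBr mulrCA cz mulrA [d * r]mulrC subrr.
have [[x' xE]|[x' rE]] := Vchain r x.
  by exists c => //; exists (x' + z); rewrite mulrDr -[r * x']mulrC -xE /x subrK.
by case/eqP: rd0; rewrite rE -mulrA [x * d]mulrC dx mulr0.
Qed.

(** One nonzero pair yields all others. If [r] divides [r0], the cofactor moves to the other side.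
    If r = d r0 is nonzero, then [d] divides [s0] and is moved across the swapped pair. *)
Lemma ann_pair_total r0 s0 : r0 != 0 -> s0 != 0 -> ann_pair r0 s0 ->
  forall r, exists s, ann_pair r s.
Proof.
move=> r00 s00 p0 r; have [->|rn] := eqVneq r 0.
  exists 1; split=> [|y]; first by rewrite mul0r.
  rewrite mul1r => ->; exists 1; first by move=> x; rewrite mul1r.
  by exists 0; rewrite !mulr0.
have [[d rE]|[d r0E]] := Vchain r0 r; last first.
  by exists (d * s0); apply: ann_pair_factor; rewrite mulrC -r0E.
have [[s s0E]|[h dE]] := Vchain d s0; last first.
  by case/eqP: rn; rewrite rE dE -mulrA [s0 * _]mulrC (proj1 p0) mulr0.
exists s; rewrite rE; apply: ann_pair_sym; rewrite -?rE //.
  by apply/eqP => s0'; case/eqP: s00; rewrite s0E s0' mul0r.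
by rewrite rE; apply: ann_pair_factor; rewrite -s0E //; exact: ann_pair_sym.
Qed.

End AnnihilatorPairs.

(** * Free modules, Lazard's criterion and flatness over chain rings *)

Section FreeModules.
Context (R : comPzRingType) (X : choiceType).
Implicit Types M N : lmodType R.

Lemma finsupp_uniq (g : freemod R X) :
  exists2 r : seq X, uniq r & forall x, val g x != 0 -> x \in r.
Proof.
have [r rP] := finsupp_seq g; exists (undup r); first exact: undup_uniq.
by move=> x /rP; rewrite mem_undup.
Qed.

Lemma linear_flift M N (h : {linear M -> N}) (f : X -> M) (g : freemod R X) :
  h (flift f g) = flift (h \o f) g.
Proof.
have [r ur gr] := finsupp_uniq g; rewrite !(flift_seq _ ur gr) linear_sum.
by apply: eq_bigr => x _; rewrite linearZ.
Qed.

Lemma eq_flift M (f f' : X -> M) (g : freemod R X) : f =1 f' -> flift f g = flift f' g.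
Proof. by move=> /funext ->. Qed.

Lemma flift_fbasis (g : freemod R X) : flift (@fbasis R X) g = g.
Proof.
have [r ur gr] := finsupp_uniq g; rewrite (flift_seq _ ur gr).
apply: val_inj; rewrite raddf_sum /=; apply/funext => y; rewrite fct_sumE.
have [yr|yr] := boolP (y \in r).
  rewrite (bigD1_seq y) //= big1 ?addr0 => [|x xy].
    by rewrite -[LHS]/(val g y * (if y == y then 1 else 0)) eqxx mulr1.
  rewrite -[LHS]/(val g x * (if y == x then 1 else 0)).
  by rewrite eq_sym (negPf xy) mulr0.
have -> : sval g y = 0 by apply: contraNeq yr; exact: gr.
rewrite big_seq big1 // => x xr; rewrite -[LHS]/(val g x * (if y == x then 1 else 0)).
by case: eqP => [yx|]; rewrite ?mulr0 //; rewrite yx xr in yr.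
Qed.

End FreeModules.

Lemma span_ind (R : comPzRingType) (M : lmodType R) (G P : set M) :
  closed_under_lin P -> (forall x, G x -> P x) -> forall x, x \in span G -> P x.
Proof.
move=> clP GP x /asboolP/(_ (submod_of clP)) h.
by apply/(submod_ofP clP)/h => y /GP/(submod_ofP clP).
Qed.

Section Flat.
Context (R : comPzRingType).
Implicit Types A M : lmodType R.

(** A derivation of zero in the tensor product uses only finitely many relations of [M]. A function
    [D] respecting these acts on [g] as a linear form on [M] would. *)
Lemma tensor_relations A M (g : freemod R (A * M)%type) :
  g \in span (@tensor_relators R A M) ->
  exists2 s : seq (freemod R M), {in s, forall q, flift id q = 0} &
    forall D : M -> R^o, {in s, forall q, flift D q = 0} ->
      flift (fun am => (D am.2 : R) *: am.1) g = 0.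
Proof.
move=> gs; pose P : set (freemod R (A * M)%type) := fun g =>
  exists2 s : seq (freemod R M), {in s, forall q, flift id q = 0} &
    forall D : M -> R^o, {in s, forall q, flift D q = 0} ->
      flift (fun am => (D am.2 : R) *: am.1) g = 0.
apply: (span_ind (P := P) _ _ gs).
  split; first by exists [::] => // D _; rewrite raddf0.
  move=> a x y [s s0 sx] [t t0 ty]; exists (s ++ t).
    by move=> q; rewrite mem_cat => /orP[/s0|/t0].
  move=> D Dst; rewrite linearP /= sx ?ty ?scaler0 ?addr0 // => q qs.
    by apply: Dst; rewrite mem_cat qs orbT.
  by apply: Dst; rewrite mem_cat qs.
move=> _ [[a [a' [m ->]]]|[a [m [m' ->]]]|[r [a [m ->]]]|[r [a [m ->]]]].
- exists [::] => // D _; rewrite !linearB /= !flift_basis /=.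
  by rewrite scalerDr addrAC addrK subrr.
- exists [:: fbasis R (m + m') - fbasis R m - fbasis R m'].
    by move=> q; rewrite inE => /eqP->; rewrite !linearB /= !flift_basis addrAC addrK subrr.
  move=> D /(_ _ (mem_head _ _)); rewrite !linearB /= !flift_basis /= => e.
  by rewrite -!scalerBl e scale0r.
- exists [::] => // D _; rewrite linearB linearZ /= !flift_basis /=.
  by rewrite !scalerA mulrC subrr.
- exists [:: fbasis R (r *: m) - r *: fbasis R m].
    by move=> q; rewrite inE => /eqP->; rewrite linearB linearZ /= !flift_basis subrr.
  move=> D /(_ _ (mem_head _ _)); rewrite !linearB linearZ /= !flift_basis /= => e.
  by rewrite linearZ /= flift_basis /= scalerA -scalerBl e scale0r.
Qed.

(* Lazard's criterion: finitely many relations between elements of [M] hold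
   already after factoring through a finite free module. *)
Definition lazard M : Prop :=
  forall (s : seq (freemod R M)) (X : seq M),
    {in s, forall q, flift id q = 0} ->
  exists (k : nat) (z : 'I_k -> M) (D : 'I_k -> M -> R^o),
    (forall l, {in s, forall q, flift (D l) q = 0}) /\
    {in X, forall x, x = \sum_(l < k) (D l x : R) *: z l}.

(** If [g] dies over [B], the functions [D l] respect the relations used there. They rewrite [g] as
    a sum of tensors of a_l with [z l], where u a_l = 0 and hence a_l = 0. *)
Lemma lazard_flat M : lazard M -> flat M.
Proof.
move=> lM A B u injU.
have u0 (t : tensor A M) : tensor_map u t = 0 -> t = 0.
  rewrite -[t]qreprK; move: (qrepr t) => g; rewrite /tensor_map.
  rewrite (qlift_proj (@tensor_map_free0 _ _ _ _ u)).
  pose h (am : A * M) := fbasis R (u am.1, am.2).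
  have -> : tensor_map_free M u g = qproj (span (@tensor_relators R B M)) (flift h g).
    by rewrite linear_flift.
  rewrite -(raddf0 (qproj (span (@tensor_relators R B M)))) => /qprojP.
  rewrite subr0 => /tensor_relations[s s0 sD].
  have [r ur gr] := finsupp_uniq g.
  have [k [z [D [D0 Dz]]]] := lM s (map snd r) s0.
  have Dl l : flift (fun am : A * M => (D l am.2 : R) *: am.1) g = 0.
    apply: injU; rewrite raddf0 linear_flift -[RHS](sD (D l) (D0 l)) linear_flift.
    by apply: eq_flift => am /=; rewrite flift_basis linearZ.
  rewrite -[in LHS](flift_fbasis g) linear_flift (flift_seq _ ur gr).
  transitivity (\sum_(l < k)
      tens (flift (fun am : A * M => (D l am.2 : R) *: am.1) g) (z l)); last first.
    rewrite big1 // => l _; rewrite Dl.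
    by rewrite -(scale0r (0 : A)) tensZl scale0r.
  have tsum l : tens (flift (fun am : A * M => (D l am.2 : R) *: am.1) g) (z l) =
      \sum_(x <- r) val g x *: ((D l x.2 : R) *: tens x.1 (z l)).
    have lt : linear (fun a : A => tens a (z l)).
      by move=> a x y; rewrite tensDl tensZl.
    rewrite -[LHS](linear_ofE lt) linear_flift (flift_seq _ ur gr).
    by apply: eq_bigr => x _ /=; rewrite tensZl.
  rewrite (eq_bigr _ (fun l _ => tsum l)) exchange_big /=.
  rewrite !big_seq; apply: eq_bigr => -[a m] xr /=; rewrite -scaler_sumr; congr (_ *: _).
  have lt : linear (fun x : M => tens a x).
    by move=> b x y; rewrite tensDr tensZr.
  have /Dz mE : m \in map snd r by apply/mapP; exists (a, m).
  rewrite -[LHS]/(tens a m) [in LHS]mE -[LHS](linear_ofE lt) linear_sum.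
  by apply: eq_bigr => l _; rewrite linearZ.
have lu := @tensor_map_is_linear R A B M u.
move=> x y xy; apply/subr0_eq/u0; rewrite -[LHS](linear_ofE lu) linearB /=.
by rewrite xy subrr.
Qed.

End Flat.

Lemma chain_ring_divides_all (V : comPzRingType) k (r : 'I_k.+1 -> V) : chain_ring V ->
  exists i, forall j, exists c, r j = c * r i.
Proof.
move=> Vc; elim: k r => [|k IH] r.
  by exists ord0 => j; exists 1; rewrite mul1r !ord1.
have [i iP] := IH (fun j => r (lift ord0 j)).
have [[c e]|[c e]] := Vc (r ord0) (r (lift ord0 i)).
  exists ord0 => j; have [j'|] := unliftP ord0 j; last by move=> ->; exists 1; rewrite mul1r.
  by move=> ->; have [d ->] := iP j'; exists (d * c); rewrite e mulrA.
exists (lift ord0 i) => j; have [j'|] := unliftP ord0 j; last by move=> ->; exists c.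
by move=> ->; exact: iP.
Qed.

(** Factor out the coefficient [r i] that divides all others. The remaining combination is killed by
    [r i], so it equals s y with r_i s = 0; replacing [z i] by [y] makes the relation hold among
    coefficients. *)
Lemma chain_ring_relation (V : comPzRingType) (M : lmodType V) : chain_ring V ->
  (forall (r : V) (x : M), r *: x = 0 -> exists s y, r * s = 0 /\ x = s *: y) ->
  forall k (r : 'I_k -> V) (z : 'I_k -> M), \sum_l r l *: z l = 0 ->
  exists (z' : 'I_k -> M) (C : 'I_k -> 'I_k -> V),
    (forall l, z l = \sum_j C l j *: z' j) /\ forall j, \sum_l r l * C l j = 0.
Proof.
move=> Vc Mdiv [|k] r z rz; first by exists z, (fun _ _ => 0); split=> -[].
have [i iP] := chain_ring_divides_all r Vc.
have [c cP] := choice iP.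
have ri : r i *: (z i + \sum_(l | l != i) c l *: z l) = 0.
  rewrite scalerDr scaler_sumr -[RHS]rz [in RHS](bigD1 i) //=; congr (_ + _).
  by apply: eq_bigr => l _; rewrite scalerA mulrC -cP.
have [s [y [rs wE]]] := Mdiv _ _ ri.
exists (fun j => if j == i then y else z j).
exists (fun l j => if l == i then (if j == i then s else - c j) else (l == j)%:R).
split=> [l|j].
  rewrite (bigD1 i) //= eqxx; have [->|li] := eqVneq l i; last first.
    rewrite scale0r add0r (bigD1 l) //= (negPf li) eqxx scale1r big1 ?addr0 //.
    by move=> j /andP[/negPf -> jl]; rewrite eq_sym (negPf jl) scale0r.
  rewrite -wE -addrA -big_split /= big1 ?addr0 // => j /negPf ji; rewrite ji.
  by rewrite scaleNr subrr.
rewrite (bigD1 i) //= eqxx; have [->|ji] := eqVneq j i.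
  by rewrite rs add0r big1 // => l /negPf li; rewrite li mulr0.
rewrite (bigD1 j) //= (negPf ji) eqxx mulr1 big1 ?addr0; last first.
  by move=> l /andP[/negPf -> /negPf lj]; rewrite lj mulr0.
by rewrite [X in _ + X]cP mulrN mulrC addNr.
Qed.

(** Relations are trivialized one at a time: the functions [D] found for the earlier ones are
    composed with the matrix [C] for the next. *)
Lemma chain_ring_flat (V : comPzRingType) (M : lmodType V) : chain_ring V ->
  (forall (r : V) (x : M), r *: x = 0 -> exists s y, r * s = 0 /\ x = s *: y) ->
  flat M.
Proof.
move=> Vc Mdiv; apply: lazard_flat => s; elim: s => [|q s IH] X s0.
  exists (size (undup X)), (fun l => nth 0 (undup X) l).
  exists (fun l x => (x == nth 0 (undup X) l)%:R); split=> // x.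
  rewrite -mem_undup => xX; have ix : (index x (undup X) < size (undup X))%N.
    by rewrite index_mem.
  rewrite (bigD1 (Ordinal ix)) //= nth_index // eqxx scale1r big1 ?addr0 // => l.
  rewrite -val_eqE /= => lx; case: eqP => [xE|]; last by rewrite scale0r.
  by case/eqP: lx; rewrite xE index_uniq ?undup_uniq.
have [r ur qr] := finsupp_uniq q.
(* The support of [q] is added to [X] so that the relation [q] can be rewritten as one between the
   [z]. *)
have [|k [z [D [D0 Dz]]]] := IH (X ++ r).
  by move=> p ps; apply: s0; rewrite inE ps orbT.
have [|z' [C [zC rC]]] := chain_ring_relation (r := fun l => flift (D l) q) (z := z) Vc Mdiv.
  rewrite -[RHS](s0 q) ?mem_head // (flift_seq _ ur qr).
  under eq_bigr => l _ do rewrite (flift_seq _ ur qr) scaler_suml.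
  rewrite exchange_big /= !big_seq; apply: eq_bigr => x xr.
  transitivity (val q x *: \sum_(l < k) (D l x : V) *: z l); last first.
    by rewrite -Dz // mem_cat xr orbT.
  rewrite scaler_sumr.
  by apply: eq_bigr => l _; rewrite scalerA.
pose D' j x : V^o := \sum_l (D l x : V) * C l j.
have D'E j p : flift (D' j) p = \sum_l (flift (D l) p : V) * C l j.
  have [t ut pt] := finsupp_uniq p; rewrite (flift_seq _ ut pt).
  under [RHS]eq_bigr => l _ do rewrite (flift_seq _ ut pt) mulr_suml.
  rewrite exchange_big /=; apply: eq_bigr => x _; rewrite /D' scaler_sumr.
  by apply: eq_bigr => l _; rewrite /GRing.scale /= mulrA.
exists k, z', D'; split=> [j p|x xX].
  rewrite D'E inE => /orP[/eqP ->|ps]; first exact: rC.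
  by rewrite big1 // => l _; rewrite D0 // mul0r.
rewrite {1}(Dz x) ?mem_cat ?xX //.
under eq_bigr => l _ do rewrite zC scaler_sumr.
rewrite exchange_big /=; apply: eq_bigr => j _; rewrite /D' scaler_suml.
by apply: eq_bigr => l _; rewrite scalerA.
Qed.

(** * Restriction of scalars and the total ring of fractions *)

Section RestrictionOfScalars.
Context (R : comPzRingType) (S : mulrClosed R).

Lemma frac_eq0 (G : lmodType R) (m : G) (s : denom S) :
  frac m s = 0 <-> exists2 u, u \in S & u *: m = 0.
Proof.
split=> [/fracP[u uS]|[u uS um]].
  by rewrite scaler0 /= mulr1 => um; exists u.
by apply/fracP; exists u; rewrite // scaler0 /= mulr1.
Qed.

Lemma frac_cancel (G : lmodType R) (m : G) (s t u : denom S) :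
  sval u = sval s * sval t -> frac (sval s *: m) u = frac m t.
Proof.
move=> us; apply/fracP; exists 1; rewrite ?rpred1 // us scalerA.
by congr (_ *: _); ring.
Qed.

Definition locscal (a : R) : locring S := frac (a : R^o) (denom1 S).

Lemma locscalE (G : lmodType R) a (m : G) (s : denom S) :
  locscal a *: frac m s = frac (a *: m) s.
Proof.
rewrite fracZ; apply/fracP; exists 1; rewrite ?rpred1 //=.
by rewrite ![1 * _]mul1r.
Qed.

Fact locscal_is_zmod : zmod_morphism locscal.
Proof.
move=> a b; rewrite /locscal; change (frac (a - b : R^o) (denom1 S) =
  loc_add (frac (a : R^o) (denom1 S)) (loc_opp (frac (b : R^o) (denom1 S)))).
by rewrite loc_oppE; exact/esym/(@frac_same R S R^o a (- b) (denom1 S)).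
Qed.

Fact locscal_is_monoid : monoid_morphism locscal.
Proof.
split=> // a b; rewrite /locscal fracM; apply/fracP; exists 1; rewrite ?rpred1 //=.
by rewrite ![1 * _]mul1r.
Qed.

HB.instance Definition _ :=
  GRing.isZmodMorphism.Build R (locring S) locscal locscal_is_zmod.
HB.instance Definition _ :=
  GRing.isMonoidMorphism.Build R (locring S) locscal locscal_is_monoid.

Definition locres (M : lmodType (locring S)) : Type := M.

Section Module.
Context (M : lmodType (locring S)).

HB.instance Definition _ := GRing.Zmodule.on (locres M).

Definition locres_scale (a : R) (x : locres M) : locres M := locscal a *: (x : M).

Fact locres_scaleA a b x :
  locres_scale a (locres_scale b x) = locres_scale (a * b) x.
Proof. by rewrite /locres_scale scalerA rmorphM. Qed.

Fact locres_scale1 : left_id 1 locres_scale.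
Proof. by move=> x; rewrite /locres_scale rmorph1 scale1r. Qed.

Fact locres_scaleDr : right_distributive locres_scale +%R.
Proof. by move=> a x y; rewrite /locres_scale scalerDr. Qed.

Fact locres_scaleDl x : {morph locres_scale^~ x : a b / a + b}.
Proof. by move=> a b /=; rewrite /locres_scale rmorphD scalerDl. Qed.

HB.instance Definition _ := GRing.Zmodule_isLmodule.Build R (locres M)
  locres_scaleA locres_scale1 locres_scaleDr locres_scaleDl.

End Module.

End RestrictionOfScalars.

Section HomElements.
Context (R : comPzRingType) (E F : lmodType R).

Definition hom_of (f : E -> F) (lf : linear f) : Hom E F :=
  exist (fun g => g \in @hom_pred R E F) f (introT (asboolP _) lf).

Lemma hom_linear (h : Hom E F) : linear (val h).
Proof. by have /asboolP := valP h. Qed.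

Lemma hom_scaleE (a : R) (h : Hom E F) x : val (a *: h) x = a *: val h x.
Proof. by []. Qed.

Lemma hom_eq (h h' : Hom E F) : (forall x, val h x = val h' x) -> h = h'.
Proof. by move=> hh; apply: val_inj; apply/funext. Qed.

End HomElements.

Section Semicoherent.
Context (V : comPzRingType).

Definition regular_pred : {pred V} := fun c => `[< regular c >].

Fact regular_pred_mulr : mulr_closed regular_pred.
Proof.
split=> [|c d /asboolP rc /asboolP rd]; apply/asboolP.
  by move=> x; rewrite mul1r.
exact: regularM.
Qed.

HB.instance Definition _ := GRing.isMulClosed.Build V regular_pred regular_pred_mulr.

Lemma regular_predP c : reflect (regular c) (c \in regular_pred).
Proof. exact: asboolP. Qed.

(** The total ring of fractions Q of [V], as a [V]-module. *)
Definition total_fractions : lmodType V :=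
  locres (locmod regular_pred V^o : lmodType (locring regular_pred)).

Definition tfrac (a : V) (t : denom regular_pred) : total_fractions :=
  frac (a : V^o) t.

Lemma tfracW (P : total_fractions -> Prop) :
  (forall a t, P (tfrac a t)) -> forall q, P q.
Proof. by move=> h q; rewrite -(fracK (q : locmod regular_pred V^o)); exact: h. Qed.

Lemma tfracZ c a t : c *: tfrac a t = tfrac (c * a) t.
Proof. exact: locscalE. Qed.

Lemma tfrac0 t : tfrac 0 t = 0.
Proof. by rewrite -[0 : V](mul0r (0 : V)) -tfracZ scale0r. Qed.

Lemma tfracD a b t : tfrac a t + tfrac b t = tfrac (a + b) t.
Proof. exact: (@frac_same V _ V^o). Qed.

Lemma tfrac_eq0 a t : tfrac a t = 0 -> a = 0.
Proof. by move/frac_eq0 => [u /regular_predP ur]; exact: ur. Qed.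

(** In Q the annihilator of [s] is r Q, where [f] vanishes. Hence s q |-> f q is well defined on s
    Q, and it extends to Q because [F] is injective. *)
Lemma hom_total_fractions_div (F : lmodType V) r s : injective_module F ->
  ann_pair r s -> forall f : Hom total_fractions F, r *: f = 0 ->
  exists g, f = s *: g.
Proof.
move=> injF [rs sP] f rf; have lf := hom_linear f.
have f0 : val f 0 = 0.
  by have := lf (-1) 0 0; rewrite !scaleN1r oppr0 addr0 => ->; rewrite addNr.
have sf q : s *: q = 0 -> val f q = 0.
  move: q; apply: (tfracW (P := fun q => s *: q = 0 -> val f q = 0)) => a t.
  rewrite tfracZ => /tfrac_eq0/sP[c rc [d cd]].
  pose c' : denom regular_pred := exist _ c (introT (regular_predP c) rc).
  have -> : tfrac a t = r *: tfrac d (denomM c' t).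
    rewrite tfracZ -cd; apply: esym; exact: (@frac_cancel V _ V^o a c' t).
  rewrite -[r *: _]addr0 lf f0 addr0.
  by rewrite -hom_scaleE rf.
have [|g gP] := injective_extends_graph injF
    (G := fun z : total_fractions * F => exists q, z = (s *: q, val f q)).
  split; first split; first by exists 0; rewrite scaler0 f0.
    move=> a _ _ [q ->] [q' ->]; exists (a *: q + q').
    rewrite lf scalerDr !scalerA mulrC; by rewrite -scalerA.
  by move=> y [q [/esym/sf sq ->]].
exists (hom_of (fun a x y => linearP g a x y)); apply: hom_eq => q.
by rewrite hom_scaleE /= -linearZ; apply/esym/gP; exists q.
Qed.

(* A divisible module is a quotient of a power of the ring of fractions [Q], so
   that [Hom(E, F)] embeds in a power of the flat module [Hom(Q, F)]. *)
Lemma ann_pair_semicoherent : chain_ring V ->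
  (forall r : V, exists s, ann_pair r s) -> semicoherent V.
Proof.
move=> Vc Vp E F injE injF.
exists (E -> Hom total_fractions F); split.
  (* Since [s] depends on [r] alone, the divisions in all coordinates of the power combine into
     one. *)
  apply: chain_ring_flat => // r h rh; have [s rs] := Vp r.
  have /choice[g gP] x : exists g, h x = s *: g.
    apply: (hom_total_fractions_div injF rs).
    by rewrite -[LHS]/((r *: h) x) rh.
  by exists s, g; split; [case: rs | apply/funext => x; rewrite gP].
(* Injectivity of [E] extends r |-> r x from [V] to Q. *)
have /choice[q qP] (x : E) : exists q : {linear total_fractions -> E},
    q (tfrac 1 (denom1 _)) = x.
  have [|q qP] := injective_extends_graph injE
      (G := fun z : total_fractions * E => exists r : V, z = (tfrac r (denom1 _), r *: x)).
    split; first split.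
    - by exists 0; rewrite scale0r tfrac0.
    - move=> a _ _ [r ->] [r' ->]; exists (a * r + r').
      by rewrite scalerDl -scalerA -tfracD -tfracZ.
    - by move=> y [r [/esym/tfrac_eq0 -> ->]]; rewrite scale0r.
  by exists q; apply: qP; exists 1; rewrite scale1r.
have lq (h : Hom E F) x : linear (fun t => val h (q x t)).
  by move=> a t t'; rewrite linearP (hom_linear h).
pose i (h : Hom E F) : E -> Hom total_fractions F := fun x => hom_of (lq h x).
have li : linear i by move=> a h h'; apply/funext => x; apply: hom_eq.
exists (linear_of li) => h h' hh'; apply: hom_eq => x.
have := congr1 (fun f : E -> Hom total_fractions F => val (f x) (tfrac 1 (denom1 _))) hh'.
by rewrite /= qP.
Qed.

End Semicoherent.

(** * Annihilators over coherent rings *)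

Section CoherentAnnihilators.
Context (R : comPzRingType).

Definition multiples (a : R) : set R^o := fun x => exists c : R, x = c * a.

Lemma multiples_closed a : closed_under_lin (multiples a).
Proof.
split; first by exists 0; rewrite mul0r.
move=> r _ _ [c ->] [d ->]; exists (r * c + d).
by rewrite mulrDl -mulrA.
Qed.

Lemma valuation_chain_ring : valuation_ring R -> chain_ring R.
Proof.
move=> Rv a b.
have mm x : (x : R^o) \in submod_of (multiples_closed x).
  by apply/submod_ofP; exists 1; rewrite mul1r.
have [h|h] := Rv (submod_of (multiples_closed a)) (submod_of (multiples_closed b)).
  by right; apply/(submod_ofP (multiples_closed b))/h/mm.
by left; apply/(submod_ofP (multiples_closed a))/h/mm.
Qed.

(** Coherence presents the ideal aR by some unknown [p]. Lift [p] through multiplication by [a] to a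
    form [beta], and let p v0 = a. For b a = 0 the vector b v0 is in the kernel, so b = b (1 - beta
    v0) + beta (b v0): the generators are 1 - beta v0, at index 0, and the values of [beta] on
    generators of the kernel. *)
Lemma coherent_ann_fin_gen (a : R) : coherent R ->
  exists n (g : 'I_n -> R), (forall i, g i * a = 0) /\
    forall b, b * a = 0 -> exists c : 'I_n -> R, b = \sum_i c i * g i.
Proof.
move=> Rcoh; pose I := submod_of (multiples_closed a).
have aI : (a : R^o) \in I by apply/submod_ofP; exists 1; rewrite mul1r.
pose aa : submod I := exist _ (a : R^o) aI.
have [|n [p [psurj [m [k kP]]]]] := Rcoh I.
  exists 1, (fun=> aa) => -[x xI]; have /(submod_ofP (multiples_closed a))[c xE] := xI.
  by exists (fun=> c); rewrite big_ord1; apply: val_inj.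
have [v0 v0P] := psurj aa.
have /choice[b bP] (i : 'I_n) : exists c : R, val (p (delta_mx 0 i)) = c * a.
  exact/(submod_ofP (multiples_closed a))/valP.
pose beta (v : 'rV[R]_n) : R := \sum_i v 0 i * b i.
have betaP v : beta v * a = val (p v).
  have -> : val (p v) = \sum_i v 0 i *: val (p (delta_mx 0 i)).
    rewrite [in LHS](row_sum_delta v) linear_sum raddf_sum.
    by apply: eq_bigr => i _; rewrite linearZ.
  by rewrite mulr_suml; apply: eq_bigr => i _; rewrite bP -mulrA.
have betaD (r : R) (u v : 'rV[R]_n) : beta (r *: u + v) = r * beta u + beta v.
  rewrite /beta mulr_sumr -big_split /=; apply: eq_bigr => i _.
  by rewrite !mxE; ring.
have kerP (v : 'rV[R]_n) : v \in ker p -> beta v * a = 0.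
  by rewrite betaP => /eqP ->.
pose g (i : 'I_(m.+1)) : R :=
  if unlift ord0 i is Some j then beta (val (k j)) else 1 - beta v0.
exists m.+1, g; split=> [i|x xa].
  rewrite /g; case: unliftP => [j _|_]; first exact/kerP/valP.
  by rewrite mulrBl mul1r betaP v0P subrr.
have xv : x *: v0 \in ker p.
  rewrite unfold_in linearZ v0P; apply/eqP/val_inj; exact: xa.
have [c cE] := kP (exist _ (x *: v0) xv).
exists (fun i => if unlift ord0 i is Some j then c j else x).
rewrite big_ord_recl /g unlift_none.
under eq_bigr => j _ do rewrite liftK.
have -> : \sum_(j < m) c j * beta (val (k j)) = x * beta v0.
  have beta0 : beta 0 = 0 by rewrite /beta big1 // => i _; rewrite mxE mul0r.
  rewrite -[RHS]addr0 -beta0 -betaD addr0.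
  have -> : x *: v0 = \sum_(j < m) c j *: val (k j).
    exact: etrans (congr1 val cE) (raddf_sum _ _ _ _).
  elim/big_ind2: _ => // [u y v z -> ->|j _].
    by rewrite -[u in RHS]scale1r betaD mul1r.
  by rewrite -[in RHS](addr0 (c j *: _)) betaD beta0 addr0.
by rewrite mulrBr mulr1 subrK.
Qed.

Lemma coherent_chain_ann (a : R) : chain_ring R -> coherent R ->
  exists2 s, s * a = 0 & forall b, b * a = 0 -> exists c, b = c * s.
Proof.
move=> Rc Rcoh; have [[|n] [g [ga gP]]] := coherent_ann_fin_gen a Rcoh.
  exists 0; first by rewrite mul0r.
  by move=> b /gP[c ->]; exists 0; rewrite big_ord0 mulr0.
have [i iP] := chain_ring_divides_all g Rc; have [d dP] := choice iP.
exists (g i) => // b /gP[c ->]; exists (\sum_j c j * d j).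
by rewrite mulr_suml; apply: eq_bigr => j _; rewrite -mulrA -dP.
Qed.

End CoherentAnnihilators.

(** If [V] is coherent, ann(a) is generated by some [b1], and some [t] in [S] kills b1 e. Then b1 =
    c t, where [c] is again in ann(a) as [t] is regular, so b1 e is a multiple of t b1 e = 0.
    Otherwise, b e <> 0 would make (b, a) a nonzero [ann_pair], and [V] semicoherent. *)
Lemma regular_annihilator (V : comPzRingType) (E : lmodType V) (S : set V) :
  chain_ring V -> coherent V \/ ~ semicoherent V ->
  (forall s r, S s -> s * r = 0 -> r = 0) ->
  forall (a b : V) (e : E), a != 0 -> b * a = 0 ->
    (forall c, c * a = 0 -> tors S (c *: e)) -> b *: e = 0.
Proof.
move=> Vc cohV Sreg a b e a0 ba ae.
apply: contrapT => /eqP be0.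
have b0 : b != 0 by apply: contraNneq be0 => ->; rewrite scale0r.
case: cohV => [coh|]; last apply.
  have [b1 b1a b1P] := coherent_chain_ann a Vc coh.
  have [d bE] := b1P _ ba; case/eqP: be0; rewrite bE -scalerA.
  have [t tS tb1] := ae _ b1a.
  have [[c tE]|[c b1E]] := Vc b1 t.
    by case/eqP: a0; apply: (Sreg t) => //; rewrite tE -mulrA b1a mulr0.
  have [|d1 cE] := b1P c; first by apply: (Sreg t) => //; rewrite mulrA [t * c]mulrC -b1E.
  have -> : b1 *: e = d1 *: (t *: (b1 *: e)).
    by rewrite {1}b1E cE !scalerA; congr (_ *: _); ring.
  by rewrite tb1 !scaler0.
apply: ann_pair_semicoherent => //; apply: (ann_pair_total Vc b0 a0).
split=> // y ay; have [[d yE]|[h bE]] := Vc b y.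
  by exists 1; [move=> x; rewrite mul1r | exists d; rewrite mul1r mulrC].
have [hr|/nonregular[w hw w0]] := pselect (regular h).
  by exists h => //; exists 1; rewrite mulr1.
have [t tS ty] : tors S (y *: e) by apply: ae; rewrite mulrC.
have [[m hE]|[m tE]] := Vc t h.
  by case/eqP: be0; rewrite bE hE -!scalerA ty scaler0.
by case/eqP: w0; apply: (Sreg t) => //; rewrite tE -mulrA hw mulr0.
Qed.

(** * Indecomposable injective modules over an arithmetical ring *)

Lemma injective_divisible (R : comPzRingType) (N : lmodType R) (u : R) :
  injective_module N -> (forall x : N, u *: x = 0 -> x = 0) ->
  forall x : N, exists y, x = u *: y.
Proof.
move=> injN uinj x.
have [|g gP] := injective_extends_graph injN
    (G := fun z : N * N => exists y, z = (u *: y, y)).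
  split; first split; first by exists 0; rewrite scaler0.
    move=> a _ _ [y ->] [z ->]; exists (a *: y + z).
    by rewrite scalerDr !scalerA mulrC -scalerA.
  by move=> y [z [/esym/uinj -> ->]].
by exists (g x); rewrite -linearZ; apply/esym/gP; exists x.
Qed.

Section LocalModule.
Context (R : comPzRingType) (P : maxIdeal R) (N : lmodType R).
Hypotheses (Pval : valuation_ring (loc_at P)).
Hypothesis Pcoh : coherent (loc_at P) \/ ~ semicoherent (loc_at P).
Hypothesis injN : injective_module N.
Hypothesis Ninj : forall u (x : N), u \in maxi_compl P -> u *: x = 0 -> x = 0.

Let V := loc_at P.
(** Elements outside [P] act bijectively on the injective module [N], so [j] identifies [N] with its
    localization [E] at [P]. *)
Let E : lmodType V := locmod (maxi_compl P) N.
Let phi (r : R) : V := locscal (maxi_compl P) r.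
Let j (x : N) : E := frac x (denom1 _).

Let jD a x y : phi a *: j x + j y = j (a *: x + y).
Proof. by rewrite locscalE frac_same. Qed.

Let jZ a x : phi a *: j x = j (a *: x).
Proof. exact: locscalE. Qed.

Let phiM a b : phi (a * b) = phi a * phi b.
Proof. exact: rmorphM. Qed.

Let phiDM a b c : phi (a * b + c) = phi a * phi b + phi c.
Proof. by rewrite -phiM; exact: rmorphD. Qed.

Let j0 : j 0 = 0.
Proof. by apply/frac_eq0; exists 1; rewrite ?rpred1 ?scaler0. Qed.

Let j_inj x : j x = 0 -> x = 0.
Proof. by move=> /frac_eq0[u uP]; apply: Ninj. Qed.

Let j_injP x y : j x = j y -> x = y.
Proof.
move=> xy; apply/subr0_eq/j_inj; rewrite addrC -scaleN1r -jD xy /phi rmorphN1.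
by rewrite scaleN1r addNr.
Qed.

Let phi_inj u (x : E) : u \in maxi_compl P -> phi u *: x = 0 -> x = 0.
Proof.
move=> uP; elim/locW: x => x t; rewrite locscalE => /frac_eq0[v vP].
by rewrite scalerA => vux; apply/frac_eq0; exists (v * u); rewrite // rpredM.
Qed.

Let j_surj (x : E) : exists y, x = j y.
Proof.
elim/locW: x => x t.
have [y ->] := injective_divisible injN (fun x => Ninj (x := x) (svalP t)) x.
by exists y; apply: frac_cancel; rewrite mulr1.
Qed.

Let phi_den (rho : V) : exists u r, u \in maxi_compl P /\ phi u * rho = phi r.
Proof.
elim/locW: rho => r t; exists (sval t), r; split; first exact: (svalP t).
rewrite -[LHS]/(phi (sval t) *: (frac (r : R^o) t : locmod (maxi_compl P) R^o)).
by rewrite locscalE; apply: (@frac_cancel _ _ R^o); rewrite mulr1.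
Qed.

Let phi_eq0 r : phi r = 0 -> exists2 u, u \in maxi_compl P & u * r = 0.
Proof. by move/frac_eq0. Qed.

(** A map from an ideal of [V] to [E] pulls back along [phi] and [j] to a map from an ideal of [R]
    to [N]. *)
Let baerE : baer E.
Proof.
move=> G [clG G0].
have [|y yP] := injective_baer injN (G := fun z => G (phi z.1 : V^o, j z.2)).
  split; first split.
  - by rewrite /= /phi rmorph0 j0; case: clG.
  - move=> a [r x] [r' x'] /= h h'; have := proj2 clG (phi a) _ _ h h'.
    rewrite -[X in G X]/(phi a * phi r + phi r' : V^o, phi a *: j x + j x') jD.
    by rewrite /phi -rmorphM -rmorphD.
  - by move=> y /=; rewrite /phi rmorph0 => /G0/j_inj.
exists (j y) => rho xi Gx; have [u [r [uP rE]]] := phi_den rho.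
have [x xE] := j_surj xi.
apply/subr0_eq/(phi_inj uP); rewrite scalerBr scalerA rE xE.
have : G (phi r : V^o, j (u *: x)).
  have := closed_scaler (phi u) clG Gx.
  by rewrite -[X in G X]/(phi u * rho : V^o, phi u *: xi) rE xE locscalE.
by move/(yP r) => e; rewrite !locscalE e subrr.
Qed.

(** The problem is carried to V = R_P and solved there by [extends_up_to_torsion]. [GV] transports
    [G] up to multipliers outside [P], which is harmless because these act injectively on [E]. *)
Lemma local_module_baer (S : mulrClosed R) : baer (locmod S N : lmodType (locring S)).
Proof.
move=> G [clG G0].
pose i (x : N) : locmod S N := frac x (denom1 S).
have iD a x y : locscal S a *: i x + i y = i (a *: x + y).
  by rewrite locscalE frac_same.
have GD a r x r' x' : G (locscal S r : (locring S)^o, i x) ->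
    G (locscal S r' : (locring S)^o, i x') ->
    G (locscal S (a * r + r') : (locring S)^o, i (a *: x + x')).
  move=> h h'; have := proj2 clG (locscal S a) _ _ h h'.
  rewrite -[X in G X]/(locscal S a * locscal S r + locscal S r' : (locring S)^o,
    locscal S a *: i x + i x') iD.
  by rewrite -rmorphM -rmorphD.
have G00 : G (locscal S 0 : (locring S)^o, i 0).
  have i0 : i 0 = 0 by apply/frac_eq0; exists 1; rewrite ?rpred1 ?scaler0.
  by rewrite rmorph0 i0; case: clG.
pose SV : set V := fun rho => exists2 s, s \in S & rho = phi s.
pose GV : set (V^o * E)%type := fun z => exists u r x,
  [/\ u \in maxi_compl P, phi u * z.1 = phi r, phi u *: z.2 = j x &
      G (locscal S r : (locring S)^o, i x)].
have SV1 : SV 1 by exists 1; rewrite ?rpred1 // /phi rmorph1.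
have SVM s t : SV s -> SV t -> SV (s * t).
  move=> [a aS ->] [b bS ->]; exists (a * b); first exact: rpredM.
  by rewrite /phi rmorphM.
have clGV : closed_under_lin GV.
  split.
    exists 1, 0, 0; split=> //=; first exact: rpred1.
      by rewrite mulr0 /phi rmorph0.
    by rewrite scaler0 j0.
  move=> a [rho xi] [rho' xi'] [u [r [x [uP /= ur ux Gx]]]] [u' [r' [x' [uP' /= ur' ux' Gx']]]].
  have [v [b [vP vb]]] := phi_den a.
  exists (u * u' * v), (b * u' * r + v * u * r'), ((b * u') *: x + (v * u) *: x').
  split.
  - by rewrite !rpredM.
  - rewrite /= -[a *: rho]/(a * rho) phiDM !phiM -ur -ur' -vb; ring.
  - rewrite /= -jD -jZ -ux -ux' !phiM -vb scalerDr !scalerA.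
    by congr (_ *: _ + _ *: _); ring.
  - apply: (GD) => //; rewrite -[_ * r']addr0 -[_ *: x']addr0; exact: (GD _ _ _ _ _ Gx' G00).
have GV0 xi : GV (0, xi) -> tors SV xi.
  move=> [u [r [x [uP /= ur ux Gx]]]].
  have [u' u'P u'r] : exists2 u', u' \in maxi_compl P & u' * r = 0.
    by apply: phi_eq0; rewrite -ur mulr0.
  have : G (0, i (u' *: x)).
    have := GD u' _ _ _ _ Gx G00; rewrite !addr0 u'r; by rewrite rmorph0.
  move/G0/frac_eq0 => [s sS]; rewrite scalerA mulrC -scalerA => /(Ninj u'P) sx.
  exists (phi s); first by exists s.
  by apply: (phi_inj uP); rewrite scalerA mulrC -scalerA ux jZ sx j0.
have [n [_ [[s0 s0S ->] nP]]] := extends_up_to_torsion (valuation_chain_ring Pval) baerE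
  SV1 SVM (regular_annihilator (valuation_chain_ring Pval) Pcoh) clGV GV0.
have [n1 nE] := j_surj n.
exists (frac n1 (exist _ s0 s0S)) => rho xi; rewrite -(fracK rho) -(fracK xi).
move: (loc_num rho) (loc_den rho) (loc_num xi) (loc_den xi) => r s x t Gx.
(* Multiplying (r / s, x / t) by s t gives a pair without denominators. *)
have Gx' : G (locscal S (sval t * r) : (locring S)^o, i (sval s *: x)).
  have := closed_scaler (locscal S (sval s * sval t)) clG Gx.
  rewrite -[X in G X]/(locscal S (sval s * sval t) *: (frac (r : R^o) s : locmod S R^o)
    : (locring S)^o, locscal S (sval s * sval t) *: frac x t).
  rewrite !locscalE.
  have -> : frac ((sval s * sval t) *: x) t = i (sval s *: x).
    by rewrite mulrC -scalerA; apply: frac_cancel; rewrite mulr1.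
  have -> // : frac ((sval s * sval t) *: (r : R^o)) s = locscal S (sval t * r) :> locmod S R^o.
  by rewrite -scalerA; apply: frac_cancel; rewrite mulr1.
have [|_ [s1 s1S ->]] := nP (phi (sval t * r)) (j (sval s *: x)).
  by exists 1, (sval t * r), (sval s *: x); rewrite rpred1 /phi rmorph1 mul1r scale1r.
rewrite nE -!phiM !jZ => /j_injP e.
rewrite fracZ; apply/fracP; exists s1 => //=.
have -> : (s1 * (sval s * s0)) *: x = (s1 * s0) *: (sval s *: x).
  by rewrite scalerA; congr (_ *: _); ring.
by rewrite e scalerA; congr (_ *: _); ring.
Qed.

End LocalModule.

Lemma maximal_ideal_above (R : comPzRingType) (L : set R^o) : closed_under_lin L ->
  ~ L 1 -> exists P : maxIdeal R, forall x, L x -> x \in maxi_ideal P.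
Proof.
move=> clL L1.
have [|C [clC LC CX maxC]] := @submod_maximal_avoiding R R^o L (fun x => x = 1) clL.
  by move=> x Lx x1; rewrite x1 in Lx.
have Cmax : maximal_ideal (submod_of clC).
  split; first by apply/negP => /(submod_ofP clC)/CX; exact.
  move=> J J1 CJ x xJ; apply/(submod_ofP clC).
  apply: (maxC (fun y => y \in J)) => //; first exact: submod_closed_under_lin.
    by move=> y Cy; apply: CJ; exact/(submod_ofP clC).
  by move=> y yJ y1; case/negP: J1; rewrite -y1.
by exists (MaxIdeal Cmax) => x /LC Cx; exact/(submod_ofP clC).
Qed.

Section Uniform.
Context (R : comPzRingType) (N : lmodType R).
Hypotheses (injN : injective_module N) (indN : indecomposable N).

Let meets0 (A B : set N) := forall x, A x -> B x -> x = 0.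

Let complement (A B : set N) : closed_under_lin A -> meets0 A B ->
  exists C : set N, [/\ closed_under_lin C, (A `<=` C)%classic, meets0 C B &
    forall D : set N, closed_under_lin D -> (C `<=` D)%classic ->
      meets0 D B -> (D `<=` C)%classic].
Proof.
move=> clA AB.
have [|C [clC AC CX maxC]] := @submod_maximal_avoiding R N A (fun x => B x /\ x != 0) clA.
  by move=> x Ax [Bx /eqP]; apply; exact: AB.
exists C; split=> //.
  by move=> x Cx Bx; apply: contrapT => /eqP x0; apply: (CX x).
move=> D clD CD DB; apply: maxC => // x Dx [Bx /eqP]; apply; exact: DB.
Qed.

(** Enlarge [A] to [C] maximal against [B], then [B] to [D] maximal against [C]. The projection of C
    + D onto [C] extends to an endomorphism [p]; maximality gives ker p = D and im p = C, so that
    [N] is the direct sum of [C] and [D]. *)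
Lemma indecomposable_injective_uniform (A B : set N) :
  closed_under_lin A -> closed_under_lin B -> meets0 A B ->
  (forall x, A x -> x = 0) \/ (forall x, B x -> x = 0).
Proof.
move=> clA clB AB.
have [C [clC AC CB maxC]] := complement clA AB.
have BC : meets0 B C by move=> x Bx Cx; exact: CB.
have [D [clD BD DC maxD]] := complement clB BC.
have [|p pP] := injective_extends_graph injN
    (G := fun z : N * N => C z.2 /\ D (z.1 - z.2)).
  split; first split.
  - by rewrite /= subrr; split; [case: clC | case: clD].
  - move=> a [x1 x2] [y1 y2] [/= Cx Dx] [/= Cy Dy]; split; first exact: (proj2 clC).
    have -> : a *: x1 + y1 - (a *: x2 + y2) = a *: (x1 - x2) + (y1 - y2).
      by rewrite scalerBr opprD addrACA.
    exact: (proj2 clD).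
  - move=> y [/= Cy]; rewrite sub0r => Dy; apply: DC Cy.
    by rewrite -[y]opprK; exact: closed_oppr.
have pC x : C x -> p x = x.
  by move=> Cx; apply: pP; rewrite /= subrr; split=> //; case: clD.
have pD x : D x -> p x = 0.
  by move=> Dx; apply: pP; rewrite /= subr0; split=> //; case: clC.
have kerD x : p x = 0 -> D x.
  move=> px; apply: (maxD (fun x => p x = 0)) => //.
  - by split=> [|a y z py pz]; rewrite ?raddf0 // linearP py pz scaler0 addr0.
  - by move=> y py /pC; rewrite py.
(* An element z = d + r x of [C] satisfies z = p z = r p(x), which lies in [D]; so D + R x meets [C]
   trivially and [x] is in [D]. *)
have imD x : D (p x) -> p x = 0.
  move=> Dpx; apply: contrapT => px0; apply: px0; apply/pD.
  apply: (maxD (fun z => exists d r, D d /\ z = d + r *: x)); last first.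
  - by exists 0, 1; rewrite scale1r add0r; split=> //; case: clD.
  - move=> _ [d [r [Dd ->]]] Cz.
    have : p (d + r *: x) = d + r *: x by exact: pC.
    rewrite linearD linearZ (pD d) //= add0r => e; rewrite -e.
    by apply: DC; [exact: closed_scaler | rewrite e].
  - by move=> d Dd; exists d, 0; rewrite scale0r addr0.
  - split; first by exists 0, 0; rewrite scale0r addr0; split=> //; case: clD.
    move=> a _ _ [d [r [Dd ->]]] [d' [r' [Dd' ->]]].
    exists (a *: d + d'), (a * r + r'); split; first exact: (proj2 clD).
    by rewrite scalerDr scalerDl scalerA addrACA.
have imC x : C (p x).
  apply: (maxC (fun y => exists x, y = p x)); last by exists x.
  - split; first by exists 0; rewrite raddf0.
    by move=> a _ _ [y ->] [z ->]; exists (a *: y + z); rewrite linearP.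
  - by move=> y Cy; exists y; rewrite pC.
  - by move=> _ [y ->] Bpy; apply/imD/BD.
have [_ ind] := indN.
have [|||] := ind (submod_of clC) (submod_of clD).
- move=> x; exists (p x), (x - p x); split; last by rewrite addrC subrK.
    exact/submod_ofP.
  by apply/(submod_ofP clD)/kerD; rewrite linearB /= (pC (p x)) ?subrr.
- by move=> x /(submod_ofP clC) Cx /(submod_ofP clD) Dx; exact: DC.
- by move=> h; left=> x /AC Cx; apply: h; exact/(submod_ofP clC).
- by move=> h; right=> x /BD Dx; apply: h; exact/(submod_ofP clD).
Qed.

(** The scalars killing some nonzero element form a proper ideal: by uniformity two nonzero cyclic
    submodules share a nonzero element, killed by both scalars. Any maximal ideal above it
    serves. *)
Lemma indecomposable_injective_local : exists P : maxIdeal R,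
  forall u (x : N), u \in maxi_compl P -> u *: x = 0 -> x = 0.
Proof.
pose cyc (x : N) : set N := fun y => exists r : R, y = r *: x.
have clcyc x : closed_under_lin (cyc x).
  split; first by exists 0; rewrite scale0r.
  move=> a _ _ [r ->] [s ->]; exists (a * r + s).
  by rewrite scalerDl scalerA.
pose L : set R^o := fun r => exists2 x : N, x != 0 & (r : R) *: x = 0.
have [[z z0] _] := indN.
have clL : closed_under_lin L.
  split; first by exists z; rewrite ?scale0r.
  move=> a r s [x x0 rx] [y y0 sy].
  have [[w [[c ->] [d cd]] w0]|nw] := pselect (exists2 w, cyc x w /\ cyc y w & w != 0).
    exists (c *: x) => //; rewrite scalerDl {2}cd.
    rewrite scalerA -[(a *: r) * c]/(a * r * c) -mulrA [r * c]mulrC mulrA -scalerA rx.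
    by rewrite scaler0 add0r scalerA mulrC -scalerA sy scaler0.
  have xy w : cyc x w -> cyc y w -> w = 0.
    by move=> xw yw; apply: contrapT => /eqP w0; apply: nw; exists w.
  have [e|e] := indecomposable_injective_uniform (clcyc x) (clcyc y) xy.
    by case/eqP: x0; apply: e; exists 1; rewrite scale1r.
  by case/eqP: y0; apply: e; exists 1; rewrite scale1r.
have [|P LP] := maximal_ideal_above clL.
  by move=> [x x0]; rewrite scale1r => /eqP; exact/negP.
exists P => u x uP ux; apply: contrapT => /eqP x0.
by move/negP: uP; apply; apply: LP; exists x.
Qed.

End Uniform.

(** * Localization of linear maps and of finite direct sums *)

Section LocMap.
Context (R : comPzRingType) (S : mulrClosed R) (M M' : lmodType R).
Context (u : {linear M -> M'}).

Definition locmap_fun (x : locmod S M) : locmod S M' :=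
  frac (u (loc_num x)) (loc_den x).

Lemma locmap_funE m s : locmap_fun (frac m s) = frac (u m) s.
Proof.
rewrite /locmap_fun; move: (fracK (frac m s)) => /fracP[v vS e].
by apply/fracP; exists v; rewrite // -!linearZ e.
Qed.

Fact locmap_fun_linear :
  linear (locmap_fun : (locmod S M : lmodType (locring S)) -> locmod S M').
Proof.
move=> a x y; elim/locW: a => a s; elim/locW: x => m t; elim/locW: y => m' t'.
by rewrite !(fracZ, fracD, locmap_funE) linearD ![u (_ *: _)]linearZ.
Qed.

Definition locmap : {linear (locmod S M : lmodType (locring S)) -> locmod S M'} :=
  linear_of locmap_fun_linear.

Lemma locmapE m s : locmap (frac m s) = frac (u m) s.
Proof. exact: locmap_funE. Qed.

End LocMap.

Lemma finite_biproduct_injective (R : comPzRingType) (E : lmodType R) n (N : 'I_n -> lmodType R)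
    (i : forall k, {linear N k -> E}) (p : forall k, {linear E -> N k}) :
  (forall x, x = \sum_k i k (p k x)) -> (forall k, injective_module (N k)) ->
  injective_module E.
Proof.
move=> ip injN B A f.
have /choice[g gP] k : exists g : {linear B -> E}, forall a, g (val a) = i k (p k (f a)).
  have [g gP] := injN k B A (p k \o f).
  by exists (i k \o g) => a /=; rewrite gP.
have lg : linear (fun b => \sum_k g k b).
  move=> a x y; rewrite scaler_sumr -big_split /=; apply: eq_bigr => k _.
  exact: linearP.
exists (linear_of lg) => a; rewrite linear_ofE [RHS]ip.
by apply: eq_bigr => k _.
Qed.

Section DirectSum.
Context (R : comPzRingType) (E : lmodType R).
Context (n : nat) (N : 'I_n -> submodClosed E) (dN : direct_sum N).

Definition summand_component (x : E) : {e : 'I_n -> E |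
    (forall i, e i \in N i) /\ x = \sum_(i < n) e i} :=
  cid (let: ex_intro2 e h1 h2 := proj1 dN x in
       ex_intro (fun e => (forall i, e i \in N i) /\ x = \sum_(i < n) e i) e (conj h1 h2)).

Definition summand_proj_fun i (x : E) : submod (N i) :=
  exist _ (sval (summand_component x) i) (proj1 (svalP (summand_component x)) i).

Lemma sum_summand_proj x : x = \sum_i val (summand_proj_fun i x).
Proof. exact: (proj2 (svalP (summand_component x))). Qed.

Fact summand_proj_linear i : linear (summand_proj_fun i).
Proof.
move=> a x y; apply: val_inj; apply/subr0_eq.
pose d k := val (summand_proj_fun k (a *: x + y)) -
  (a *: val (summand_proj_fun k x) + val (summand_proj_fun k y)).
have dN0 k : d k \in N k 
  by rewrite /d addrC -scaleN1r !(rpredD, rpredZ) //; exact: valP.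
apply: ((proj2 dN) d dN0).
rewrite /d sumrB big_split /= -scaler_sumr -!sum_summand_proj.
by rewrite subrr.
Qed.

Definition summand_proj i : {linear E -> submod (N i)} := linear_of (summand_proj_linear i).

Lemma injective_localization_sum (S : mulrClosed R) :
  (forall i, injective_module (locmod S (submod (N i)) : lmodType (locring S))) ->
  injective_module (locmod S E : lmodType (locring S)).
Proof.
move=> injN.
pose i k := locmap S (val : {linear submod (N k) -> E}).
pose p k := locmap S (summand_proj k).
suff ip (x : locmod S E) : x = \sum_k i k (p k x).
  exact: (@finite_biproduct_injective _ _ _ _ i p ip injN).
move: x; elim/locW => m s.
have mE : frac m s = \sum_k frac (val (summand_proj k m)) s :> locmod S E.
  rewrite [in LHS](sum_summand_proj m); elim/big_ind2: _ => // [|x y x' y' <- <-].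
    by apply/frac_eq0; exists 1; rewrite ?rpred1 ?scaler0.
  by rewrite frac_same.
by rewrite [LHS]mE; apply: eq_bigr => k _; rewrite /i /p !locmapE.
Qed.

End DirectSum.

Theorem injective_localization (R : comPzRingType) (S : mulrClosed R) (E : lmodType R)
    n (N : 'I_n -> submodClosed E) : arithmetical R ->
  (forall P : maxIdeal R, coherent (loc_at P) \/ ~ semicoherent (loc_at P)) ->
  direct_sum N ->
  (forall i, injective_module (submod (N i)) /\ indecomposable (submod (N i))) ->
  injective_module (locmod S E : lmodType (locring S)).
Proof.
move=> Rarith Rcoh dN NP; apply: (injective_localization_sum dN) => i.
have [injN indN] := NP i.
have [P uP] := indecomposable_injective_local injN indN.
exact/baer_injective/(local_module_baer (Rarith P) (Rcoh P) injN uP).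
Qed.

(** * Finitely injective and FP-injective modules *)

Section Spans.
Context (R : comPzRingType) (M : lmodType R).

Definition combinations n (g : 'I_n -> M) : set M :=
  fun x => exists c : 'I_n -> R, x = \sum_i c i *: g i.

Lemma combinations_closed n (g : 'I_n -> M) : closed_under_lin (combinations g).
Proof.
split; first by exists (fun=> 0); rewrite big1 // => i _; rewrite scale0r.
move=> a _ _ [c ->] [d ->]; exists (fun i => a * c i + d i).
rewrite scaler_sumr -big_split /=; apply: eq_bigr => i _.
by rewrite scalerDl scalerA.
Qed.

Lemma combinations_gen n (g : 'I_n -> M) i : combinations g (g i).
Proof.
exists (fun k => (k == i)%:R); rewrite (bigD1 i) //= eqxx scale1r big1 ?addr0 //.
by move=> k /negPf ->; rewrite scale0r.
Qed.

Lemma combinations_sub n (g : 'I_n -> M) (A : set M) : closed_under_lin A ->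
  (forall i, A (g i)) -> forall x, combinations g x -> A x.
Proof.
by move=> clA gA _ [c ->]; apply: closed_sum => // i _; apply: closed_scaler.
Qed.

Lemma fin_gen_submod (A : submodClosed M) n (g : 'I_n -> M) :
  (forall x, x \in A <-> combinations g x) -> fin_gen (submod A).
Proof.
move=> AP; have gA i : g i \in A by apply/AP/combinations_gen.
exists n, (fun i => exist _ (g i) (gA i)) => -[x xA].
have /AP[c xE] := xA; exists c; apply: val_inj.
by rewrite raddf_sum /= xE; apply: eq_bigr.
Qed.

Lemma fin_gen_combinations n (g : 'I_n -> M) :
  fin_gen (submod (submod_of (combinations_closed g))).
Proof.
apply: (@fin_gen_submod _ n g) => x.
by split=> [/(submod_ofP (combinations_closed g))|?] //; apply/submod_ofP.
Qed.

End Spans.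

Lemma finitely_injective_extends_graph (R : comPzRingType) (G : lmodType R) :
  finitely_injective G ->
  forall (B : lmodType R) (H : set (B * G)%type), functional_graph H ->
  forall n (b : 'I_n -> B), (forall x, (exists y, H (x, y)) <-> combinations b x) ->
  exists g : {linear B -> G}, forall x y, H (x, y) -> g x = y.
Proof.
move=> finG B H /functional_graph_map[A [f [AP fP]]] n b bP.
have [|g gP] := finG B A _ f.
  by apply: (fin_gen_submod (g := b)) => x; rewrite AP.
exists g => x y xy; have xA : x \in A by apply/AP; exists y.
by rewrite -(fP (exist _ x xA) y xy) -gP.
Qed.

Section Localization.
Context (R : comPzRingType).
Hypothesis R_arith : arithmetical R.
Hypothesis R_loc : forall P : maxIdeal R,
  coherent (loc_at P) \/ ~ semicoherent (loc_at P).
Hypothesis R_goldie : forall M : lmodType R, fin_gen M -> finite_goldie_dim M.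

(** Condition (b) enters here: it decomposes the injective hull into finitely many summands, to
    which [injective_localization] applies. *)
Lemma fin_gen_hull (M : lmodType R) : fin_gen M ->
  exists (E : lmodType R) (j : {linear M -> E}),
    [/\ injective j, injective_module E &
        forall S : mulrClosed R, injective_module (locmod S E : lmodType (locring S))].
Proof.
move=> /R_goldie[n [E [j [[injE jinj _] [N [dN NP]]]]]].
by exists E, j; split=> // S; exact: (@injective_localization R S E n N R_arith R_loc dN NP).
Qed.

(** The values of [f] lie in S^-1 M, where [M] is spanned by finitely many numerators in [G]. The
    inclusion of [M] in [G] extends along [j] to [h] on [E], and [f] viewed in the injective module
    S^-1 E extends to [g']; the composite of [g'] and S^-1 h extends [f]. *)
Lemma finitely_injective_localization (S : mulrClosed R) (G : lmodType R) :
  finitely_injective G -> finitely_injective (locmod S G : lmodType (locring S)).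
Proof.
move=> finG B A [n [a aP]] f.
have /choice[g gP] i : exists x : G, exists s, f (a i) = frac x s.
  by exists (loc_num (f (a i))), (loc_den (f (a i))); rewrite fracK.
pose M := submod (submod_of (combinations_closed g)).
have [E [j [jinj injE SinjE]]] := @fin_gen_hull M (fin_gen_combinations g).
have [k [e eP]] : exists k (e : 'I_k -> M), forall x : M, combinations e x.
  by have [k [e eP]] := fin_gen_combinations g; exists k, e.
have [||h hP] := @finitely_injective_extends_graph R G finG E
    (fun z => exists m : M, z = (j m, val m)) _ k (fun i => j (e i)).
- split; first split; first by exists 0; rewrite !raddf0.
    move=> r _ _ [m ->] [m' ->]; exists (r *: m + m').
    by rewrite !linearP.
  by move=> y [m [/esym]]; rewrite -{1}(raddf0 j) => /jinj -> ->.
- move=> x; split.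
    move=> [y [m [-> _]]]; have [c ->] := eP m; exists c.
    by rewrite linear_sum; apply: eq_bigr => i _; rewrite linearZ.
  move=> [c ->]; exists (val (\sum_i c i *: e i)), (\sum_i c i *: e i).
  have -> // : j (\sum_i c i *: e i) = \sum_i c i *: j (e i).
  by rewrite linear_sum; apply: eq_bigr => i _; rewrite linearZ.
have SinjE' := SinjE S.
pose H : set (B * (locmod S E : lmodType (locring S)))%type := fun z =>
  exists (x : submod A) (m : M) s,
    [/\ z.1 = val x, f x = frac (val m) s & z.2 = frac (j m) s].
have fH : functional_graph H.
  split; first split.
  - exists 0, 0, (denom1 S); split; rewrite ?raddf0 //; apply: esym;
      by apply/frac_eq0; exists 1; rewrite ?rpred1 ?scaler0.
  - move=> r [b1 e1] [b2 e2] [x [m [s [/= -> fx ->]]]] [x' [m' [s' [/= -> fx' ->]]]].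
    rewrite -(fracK r); move: (loc_num r) (loc_den r) => r0 t.
    exists ((frac r0 t : locring S) *: x + x').
    exists (sval s' *: ((r0 : R) *: m) + sval (denomM t s) *: m'), (denomM (denomM t s) s').
    split.
    - by [].
    - by rewrite linearP fx fx' fracZ fracD.
    - have -> : j (sval s' *: ((r0 : R) *: m) + sval (denomM t s) *: m') =
          sval s' *: ((r0 : R) *: j m) + sval (denomM t s) *: j m'.
        by rewrite linearD; congr (_ + _); rewrite linearZ //; congr (_ *: _); rewrite linearZ.
      exact: etrans (congr1 (fun z => z + _) (fracZ _ _ _ _)) (fracD _ _ _ _).
  - move=> y [x [m [s [/= x0 fx ->]]]].
    have xE : x = 0 by apply: val_inj; exact: esym x0.
    move: fx; rewrite xE raddf0 => /esym/frac_eq0[u uS um].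
    apply/frac_eq0; exists u => //; rewrite -linearZ.
    have -> : u *: m = 0 by apply: val_inj.
    by rewrite raddf0.
have [g' g'P] := injective_extends_graph SinjE' fH.
exists (locmap S h \o g') => x.
suff [m [s fx]] : exists (m : M) s, f x = frac (val m) s.
  rewrite -[LHS]/(locmap S h (g' (val x))) (g'P _ (frac (j m) s)); last by exists x, m, s.
  by rewrite locmapE fx; congr (frac _ _); apply: hP; exists m.
have [c ->] := aP x; rewrite linear_sum.
elim/big_ind: _.
- exists 0, (denom1 S); apply: esym; apply/frac_eq0.
  by exists 1; rewrite ?rpred1 ?scaler0.
- move=> y y' [m [s ->]] [m' [s' ->]].
  by exists (sval s' *: m + sval s *: m'), (denomM s s'); rewrite fracD.
- move=> i _; rewrite linearZ /=; have [s ->] := gP i.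
  rewrite -(fracK (c i)); move: (loc_num (c i)) (loc_den (c i)) => r0 t.
  have gM : g i \in submod_of (combinations_closed g).
    by apply/submod_ofP; exact: combinations_gen.
  exists ((r0 : R) *: (exist _ (g i) gM : M)), (denomM t s).
  by rewrite fracZ.
Qed.

End Localization.

(** * FP-injectivity as solvability of finite linear systems *)

Section FPInjective.
Context (R : comPzRingType).
Implicit Types (E F P : lmodType R).

Definition extends_from_kernel P F (p : {linear P -> F}) E : Prop :=
  forall h : {linear submod (ker p) -> E},
    exists g : {linear P -> E}, forall k, g (val k) = h k.

(** If H extends h a from ker p1 to [P1], then H b - h (a b - 1) extends [h]. Thus Ext^1 can be
    tested on a finite presentation instead of the one defining [Ext1]. *)
Lemma extends_from_kernel_independent E F P1 P2 (p1 : {linear P1 -> F})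
    (p2 : {linear P2 -> F}) (a : {linear P1 -> P2}) (b : {linear P2 -> P1}) :
  (forall x, p2 (a x) = p1 x) -> (forall x, p1 (b x) = p2 x) ->
  extends_from_kernel p1 E -> extends_from_kernel p2 E.
Proof.
move=> ap bp ext1 h.
have aK (k : submod (ker p1)) : a (val k) \in ker p2.
  by rewrite unfold_in ap; exact: (valP k).
have bK (k : submod (ker p2)) : b (val k) \in ker p1.
  by rewrite unfold_in bp; exact: (valP k).
have abK x : a (b x) - x \in ker p2 by rewrite unfold_in linearB ap bp subrr.
pose a' (k : submod (ker p1)) : submod (ker p2) := exist _ (a (val k)) (aK k).
pose c x : submod (ker p2) := exist _ (a (b x) - x) (abK x).
have la : linear (fun k => h (a' k)).
  by move=> r x y; rewrite -linearP; congr (h _); apply: val_inj; rewrite /= !linearP.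
have [H HP] := ext1 (linear_of la).
have lg : linear (fun x => H (b x) - h (c x)).
  move=> r x y; have -> : c (r *: x + y) = r *: c x + c y.
    apply: val_inj.
    change (a (b (r *: x + y)) - (r *: x + y) = r *: (a (b x) - x) + (a (b y) - y)).
    by rewrite (linearP b) (linearP a) scalerBr opprD addrACA.
  by rewrite (linearP b) (linearP H) (linearP h) scalerBr opprD addrACA.
exists (linear_of lg) => k; rewrite linear_ofE.
pose bk : submod (ker p1) := exist _ (b (val k)) (bK k).
have -> : c (val k) = a' bk - k by apply: val_inj.
by rewrite linearB -[b _]/(val bk) HP subKr.
Qed.

Lemma Ext1_eq0 F E : (forall x : Ext1 F E, x = 0) <-> extends_from_kernel (ext_proj F) E.
Proof.
split=> [ext0 h|ext x].
  have : qproj (@ext_restr_pred R F E) (hom_of (fun a => linearP h a)) = qproj _ 0.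
    by rewrite raddf0; exact: ext0.
  move/qprojP; rewrite subr0 => /asboolP[g gP].
  by exists (linear_of (hom_linear g)) => k; rewrite linear_ofE -gP.
rewrite -[x]qreprK -(raddf0 (qproj (@ext_restr_pred R F E))); apply/qprojP.
rewrite subr0; apply/asboolP; have [g gP] := ext (linear_of (hom_linear (qrepr x))).
by exists (hom_of (fun a => linearP g a)) => k; rewrite /= gP.
Qed.

Lemma free_presentation_lifts F n (p : {linear 'rV[R]_n -> F}) :
  (forall x, exists v, p v = x) ->
  exists (a : {linear 'rV[R]_n -> freemod R F}) (b : {linear freemod R F -> 'rV[R]_n}),
    (forall x, ext_proj F (a x) = p x) /\ (forall x, p (b x) = ext_proj F x).
Proof.
move=> /choice[q qP].
have la : linear (fun v : 'rV[R]_n => \sum_i v 0 i *: fbasis R (p (delta_mx 0 i))).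
  move=> r v w; rewrite scaler_sumr -big_split /=; apply: eq_bigr => i _.
  by rewrite !mxE scalerDl scalerA.
exists (linear_of la), (flift q); split=> x.
  rewrite linear_ofE [in RHS](row_sum_delta x) !linear_sum; apply: eq_bigr => i _.
  by rewrite !linearZ /ext_proj /= flift_basis.
by rewrite linear_flift /ext_proj; apply: eq_flift => y; exact: qP.
Qed.

(** The elementary form of FP-injectivity; each instance involves finitely many elements, so common
    denominators can be taken. *)
Definition solvable_systems E : Prop :=
  forall m n (A : 'I_m -> 'I_n -> R) (x : 'I_m -> E),
    (forall v : 'I_m -> R, (forall j, \sum_i v i * A i j = 0) -> \sum_i v i *: x i = 0) ->
  exists y : 'I_n -> E, forall i, x i = \sum_j A i j *: y j.

Section System.
Context (E : lmodType R) (m n : nat) (A : 'I_m -> 'I_n -> R) (x : 'I_m -> E).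
Hypothesis compat : forall v : 'I_m -> R,
  (forall j, \sum_i v i * A i j = 0) -> \sum_i v i *: x i = 0.

(** The map from the row space of [A] that sends row i to [x i]. *)
Definition system_graph : set ('rV[R]_n * E)%type := fun z =>
  exists v : 'I_m -> R, z.1 = \sum_i v i *: \row_j A i j /\ z.2 = \sum_i v i *: x i.

Lemma system_graph_functional : functional_graph system_graph.
Proof.
split; first split.
- exists (fun=> 0); rewrite !big1 // => i _; by rewrite scale0r.
- move=> r [_ _] [_ _] [v [/= -> ->]] [w [/= -> ->]]; exists (fun i => r * v i + w i).
  by split; rewrite /= scaler_sumr -big_split /=; apply: eq_bigr => i _;
    rewrite scalerDl scalerA.
- move=> y [v [/= v0 ->]]; apply: compat => j.
  have := congr1 (fun u : 'rV[R]_n => u 0 j) v0; rewrite mxE summxE => /esym e.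
  by rewrite -[RHS]e; apply: eq_bigr => i _; rewrite !mxE.
Qed.

Lemma system_graph_row i : system_graph (\row_j A i j, x i).
Proof.
exists (fun k => (k == i)%:R); split=> /=;
  rewrite (bigD1 i) //= eqxx scale1r big1 ?addr0 // => k /negPf ->; by rewrite scale0r.
Qed.

Lemma system_solution (g : {linear 'rV[R]_n -> E}) :
  (forall u y, system_graph (u, y) -> g u = y) ->
  forall i, x i = \sum_j A i j *: g (delta_mx 0 j).
Proof.
move=> gP i; rewrite -(gP _ _ (system_graph_row i)) [in LHS](row_sum_delta (\row_j A i j)).
by rewrite linear_sum; apply: eq_bigr => j _; rewrite linearZ mxE.
Qed.

End System.

Lemma injective_solvable_systems E : injective_module E -> solvable_systems E.
Proof.
move=> injE m n A x compat.
have [g gP] := injective_extends_graph injE (system_graph_functional compat).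
exists (fun j => g (delta_mx 0 j)); exact: system_solution.
Qed.

(** A compatible system is a map to [E] from the row space of its matrix, that is, from the kernel
    of a finite presentation, and its solutions are the extensions to R^n. *)
Lemma FP_injective_solvable_systems E : FP_injective E <-> solvable_systems E.
Proof.
split=> [fpE m n A x compat|solE F [n [p [psurj [m [k kP]]]]]].
  have clK := combinations_closed (fun i : 'I_m => \row_j A i j).
  pose K := submod_of clK.
  have psurj (y : quotmod K) : exists v, qproj K v = y by exists (qrepr y); rewrite qreprK.
  have kerP (v : 'rV_n) : v \in ker (qproj K) <-> combinations (fun i : 'I_m => \row_j A i j) v.
    rewrite unfold_in; split.
      move=> /eqP; rewrite -(raddf0 (qproj K)) => /qprojP; rewrite subr0.
      by move/(submod_ofP clK).
    move=> vK; apply/eqP; rewrite -(raddf0 (qproj K)); apply/qprojP.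
    by rewrite subr0; apply/(submod_ofP clK).
  have fpK : fin_pres (quotmod K).
    by exists n, (qproj K); split=> //; exact: (fin_gen_submod kerP).
  have [a [b [aP bP]]] := free_presentation_lifts psurj.
  have /Ext1_eq0 ext := fpE _ fpK.
  have := extends_from_kernel_independent bP aP ext.
  have [D [f [DP fP]]] := functional_graph_map (system_graph_functional compat).
  have DK v : v \in ker (qproj K) -> v \in D.
    by move=> /kerP[c ->]; apply/DP; exists (\sum_i c i *: x i), c.
  pose i (v : submod (ker (qproj K))) : submod D := exist _ (val v) (DK _ (valP v)).
  have li : linear (fun v => f (i v)).
    by move=> r u v; rewrite -linearP; congr (f _); apply: val_inj.
  move=> /(_ (linear_of li))[g gP].
  exists (fun j => g (delta_mx 0 j)); apply: system_solution => v y vy.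
  have vK : v \in ker (qproj K) by apply/kerP; case: vy => c [/= -> _]; exists c.
  by rewrite -[v]/(val (exist (fun v => v \in ker (qproj K)) v vK)) gP; apply: fP.
have [a [b [aP bP]]] := free_presentation_lifts psurj.
apply/Ext1_eq0/(extends_from_kernel_independent aP bP) => h.
have [|y yP] := solE m n (fun i j => (val (k i) : 'rV_n) 0 j) (fun i => h (k i)).
  move=> v v0; have : \sum_i v i *: k i = 0.
    apply: val_inj; rewrite raddf_sum /=; apply/rowP => j; rewrite summxE mxE -[RHS](v0 j).
    by apply: eq_bigr => i _; rewrite mxE.
  move/(congr1 h); rewrite raddf0 linear_sum => e; rewrite -[RHS]e.
  by apply: eq_bigr => i _; rewrite linearZ.
have lg : linear (fun v : 'rV[R]_n => \sum_j v 0 j *: y j).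
  move=> r v w; rewrite scaler_sumr -big_split /=; apply: eq_bigr => i _.
  by rewrite !mxE scalerDl scalerA.
exists (linear_of lg) => u; have [c ->] := kP u.
rewrite raddf_sum !linear_sum; apply: eq_bigr => i _.
rewrite -[X in linear_of lg X]/(c i *: val (k i)).
by rewrite [LHS]linearZ [RHS]linearZ yP.
Qed.

End FPInjective.

Section FPInjectiveLocalization.
Context (R : comPzRingType).

Lemma common_denominator (S : mulrClosed R) (M : lmodType R) (I : finType)
    (x : I -> locmod S M) :
  exists (s : denom S) (m : I -> M), forall i, x i = frac (m i) s.
Proof.
have sS : \prod_i sval (loc_den (x i)) \in S
  by apply: rpred_prod => i _; exact: (svalP (loc_den (x i))).
exists (exist (fun s => s \in S) _ sS).
exists (fun i => (\prod_(k | k != i) sval (loc_den (x k))) *: loc_num (x i)).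
move=> i; rewrite -[LHS]fracK; apply/fracP; exists 1; rewrite ?rpred1 //=.
by rewrite (bigD1 i) //= !mul1r scalerA.
Qed.

Lemma frac_sum (S : mulrClosed R) (M : lmodType R) (I : finType) (m : I -> M) s :
  \sum_i frac (m i) s = frac (\sum_i m i) s :> locmod S M.
Proof.
elim/big_ind2: _ => // [|x y x' y' -> ->]; last exact: frac_same.
by apply: esym; apply/frac_eq0; exists 1; rewrite ?rpred1 ?scaler0.
Qed.

Hypothesis R_arith : arithmetical R.
Hypothesis R_loc : forall P : maxIdeal R,
  coherent (loc_at P) \/ ~ semicoherent (loc_at P).
Hypothesis R_goldie : forall M : lmodType R, fin_gen M -> finite_goldie_dim M.

(** The system is first solved in S^-1 E, with [E] a hull of the span of the numerators [b].
    Clearing denominators makes the system with right-hand side c b compatible over [R], as [j] is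
    injective; it is then solved in [G]. *)
Lemma solvable_systems_localization (S : mulrClosed R) (G : lmodType R) :
  solvable_systems G -> solvable_systems (locmod S G : lmodType (locring S)).
Proof.
move=> solG m n A x compat.
have [s [a aP]] := common_denominator (fun ij : 'I_m * 'I_n => A ij.1 ij.2 : locmod S R^o).
have [t [b bP]] := common_denominator x.
have AE i j : A i j = frac (a (i, j)) s by rewrite -(aP (i, j)).
have [E [j [jinj injE SinjE]]] := fin_gen_hull R_arith R_loc R_goldie (fin_gen_combinations b).
have bM i : b i \in submod_of (combinations_closed b).
  by apply/submod_ofP; exact: combinations_gen.
pose b' i : submod (submod_of (combinations_closed b)) := exist _ (b i) (bM i).
have [|y yP] := injective_solvable_systems (SinjE S)
    (A := A) (x := fun i => frac (j (b' i)) t).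
  move=> v /compat; have [r [w wP]] := common_denominator (v : 'I_m -> locmod S R^o).
  have fE (M : lmodType R) (c : 'I_m -> M) :
      \sum_i v i *: frac (c i) t = frac (\sum_i (w i : R) *: c i) (denomM r t) :> locmod S M.
    by rewrite -frac_sum; apply: eq_bigr => i _; rewrite wP fracZ.
  under eq_bigr => i _ do rewrite bP.
  rewrite !fE => /frac_eq0[u uS ub]; apply/frac_eq0; exists u => //.
  have e : u *: (\sum_i (w i : R) *: b' i) = 0.
    apply: val_inj; rewrite -[LHS]/(u *: val (\sum_i (w i : R) *: b' i)) raddf_sum.
    exact: ub.
  move: e => /(congr1 j); rewrite raddf0 linearZ linear_sum /= => e.
  by rewrite -[RHS]e; congr (_ *: _); apply: eq_bigr => i _; rewrite linearZ.
have [r [e eP]] := common_denominator y.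
have /choice[u uP] i : exists u, u \in S /\
    (u * (sval s * sval r)) *: j (b' i) = (u * sval t) *: \sum_k (a (i, k) : R) *: e k.
  have : frac (\sum_k (a (i, k) : R) *: e k) (denomM s r) = frac (j (b' i)) t.
    rewrite yP -frac_sum; apply: eq_bigr => k _; rewrite eP AE.
    exact: esym (fracZ _ _ _ _).
  by move=> /fracP[u uS ue]; exists u.
pose U := \prod_i u i.
have US : U \in S by apply: rpred_prod => i _; case: (uP i).
have Ue i : (U * (sval s * sval r)) *: j (b' i) = (U * sval t) *: \sum_k (a (i, k) : R) *: e k.
  have [_ ue] := uP i; rewrite /U (bigD1 i) //= [u i * _]mulrC -!mulrA -scalerA ue.
  by rewrite scalerA.
(* [c] gathers the denominators of the matrix and of the solution in S^-1 E, and one multiplier [U]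
   for all equations. *)
pose c := U * (sval s * sval r).
have [|z zP] := solG m n (fun i k => a (i, k)) (fun i => c *: b i).
  move=> v v0; have : j (\sum_i v i *: (c *: b' i)) = 0.
    rewrite linear_sum (eq_bigr (fun i => (U * sval t) *:
        \sum_k (v i * a (i, k)) *: e k)); last first.
      move=> i _; rewrite linearZ; have -> : j (c *: b' i) = c *: j (b' i) by rewrite linearZ.
      rewrite Ue; transitivity ((U * sval t) *: (v i *: \sum_k (a (i, k) : R) *: e k)).
        by rewrite /= !scalerA mulrC.
      congr (_ *: _); rewrite scaler_sumr.
      by apply: eq_bigr => k _; rewrite scalerA.
    rewrite -scaler_sumr exchange_big /= big1 ?scaler0 // => k _.
    by rewrite -scaler_suml v0 scale0r.
  rewrite -(raddf0 j) => /jinj/(congr1 val); rewrite raddf_sum.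
  exact.
have denS (d : denom S) : sval d \in S by exact: svalP d.
have dS : sval s * (c * sval t) \in S by rewrite /c !rpredM ?denS.
have cS : c * sval t \in S by rewrite /c !rpredM ?denS.
pose c' : denom S := exist (fun s => s \in S) _ cS.
pose d' : denom S := exist (fun s => s \in S) _ dS.
(* The factor [s] cancels the denominator of [A]; dividing by c t turns c b into b / t. *)
exists (fun k => frac (sval s *: z k) c') => i; rewrite bP.
transitivity (\sum_k frac (sval s *: ((a (i, k) : R) *: z k)) d' : locmod S G).
  rewrite frac_sum -scaler_sumr -zP; apply: esym.
  have scS : sval s * c \in S by rewrite /c !rpredM ?denS.
  rewrite scalerA; apply: (@frac_cancel _ _ _ _ (exist (fun s => s \in S) _ scS)).
  by rewrite /= mulrA.
apply: eq_bigr => k _; rewrite AE [RHS]fracZ; congr (frac _ _); last exact: val_inj.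
by rewrite !scalerA mulrC.
Qed.

End FPInjectiveLocalization.

(** * Coherence *)

Section Coherence.
Context (R : comPzRingType).
Hypothesis R_arith : arithmetical R.
Hypothesis R_coh : forall P : maxIdeal R, coherent (loc_at P).
Hypothesis R_goldie : forall M : lmodType R, fin_gen M -> finite_goldie_dim M.

(* The point is that [u] does not depend on [b]; it comes from dividing the
   image of [1] by [a] in the localization of an injective hull of [R / sR]. *)
Lemma uniform_local_annihilator (P : maxIdeal R) (a : R) :
  exists s u, [/\ s * a = 0, u \in maxi_compl P &
    forall b, b * a = 0 -> exists d, u * b = d * s].
Proof.
pose phi := locscal (maxi_compl P).
have phiM x y : phi (x * y) = phi x * phi y by exact: rmorphM.
have Vc := valuation_chain_ring (@R_arith P).
have [sg sga sgP] := coherent_chain_ann (phi a) Vc (@R_coh P).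
(* A generator s0 / t of the annihilator in R_P is replaced by u s0, where [u] outside [P] kills s0
   a; both generate the same ideal, [u] and [t] being units in R_P. *)
have [s [sa sP]] : exists s, s * a = 0 /\
    forall v : loc_at P, v * phi a = 0 -> exists g, v = g * phi s.
  move: sga sgP; rewrite -(fracK sg); move: (loc_num sg) (loc_den sg) => s0 t.
  have tE : (frac s0 t : loc_at P) * phi (sval t) = phi s0.
    rewrite mulrC -[LHS]/(phi (sval t) *: (frac s0 t : locmod (maxi_compl P) R^o)).
    by rewrite locscalE; apply: (@frac_cancel _ _ R^o); rewrite mulr1.
  move=> sga sgP; have : phi (s0 * a) = 0.
    by rewrite phiM -tE mulrAC sga mul0r.
  move=> /frac_eq0[u uP ua]; exists (u * s0); split; first by rewrite -mulrA.
  move=> v /sgP[g ->].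
  pose ut := denomM (exist (fun s => s \in maxi_compl P) u uP) t.
  exists (g * (frac (1 : R^o) ut : loc_at P)); rewrite -mulrA; congr (_ * _).
  apply: esym; rewrite mulrC -[LHS]/(phi (u * s0) *:
    (frac (1 : R^o) ut : locmod (maxi_compl P) R^o)).
  rewrite locscalE; have -> : (u * s0) *: (1 : R^o) = u *: (s0 : R^o).
    by rewrite /GRing.scale /= mulr1.
  exact: (@frac_cancel _ _ R^o s0 (exist (fun s => s \in maxi_compl P) u uP)).
pose M : lmodType R := quotmod (submod_of (multiples_closed s)).
have fgM : fin_gen M.
  exists 1, (fun=> qproj _ (1 : R^o)) => x; exists (fun=> qrepr x).
  rewrite big_ord1 -linearZ -[_ *: _]/(qrepr x * 1) mulr1.
  exact: (esym (qreprK x)).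
have [|E [j [jinj _ /(_ (maxi_compl P)) injE]]] := fin_gen_hull R_arith _ R_goldie fgM.
  by left.
pose one : M := qproj _ (1 : R^o).
have oneP r : r *: one = 0 -> exists d, r = d * s.
  rewrite -linearZ -(raddf0 (qproj (submod_of (multiples_closed s)))) => /qprojP.
  by rewrite subr0 -[_ *: _]/(r * 1) mulr1 => /(submod_ofP (multiples_closed s)).
have s1 : s *: one = 0.
  rewrite -linearZ -(raddf0 (qproj (submod_of (multiples_closed s)))); apply/qprojP.
  rewrite subr0 -[_ *: _]/(s * 1) mulr1; apply/(submod_ofP (multiples_closed s)).
  by exists 1; rewrite mul1r.
pose e : locmod (maxi_compl P) E := frac (j one) (denom1 _).
(* The equation e = a y is compatible because the annihilator of [a] in R_P is generated by [s],
   which kills [one]. *)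
have [|y yP] := injective_solvable_systems injE (m := 1) (n := 1)
    (A := fun _ _ => phi a) (x := fun=> e).
  move=> v /(_ ord0); rewrite !big_ord1 => /sP[g ->].
  rewrite -scalerA locscalE -linearZ s1 raddf0.
  by have -> : frac 0 (denom1 _) = 0 :> locmod (maxi_compl P) E;
    rewrite ?scaler0 //; apply/frac_eq0; exists 1; rewrite ?rpred1 ?scaler0.
have := yP ord0; rewrite big_ord1 -(fracK (y ord0)).
move: (loc_num (y ord0)) (loc_den (y ord0)) => w r.
rewrite locscalE => /fracP[u uP]; rewrite /= mulr1 => ue.
exists s, (u * sval r); split=> //; first by rewrite rpredM // (svalP r).
move=> b ba; apply/oneP/jinj; rewrite raddf0 linearZ /= mulrC -scalerA ue.
transitivity ((u * (b * a)) *: w); last by rewrite ba mulr0 scale0r.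
by rewrite !scalerA; congr (_ *: _); ring.
Qed.

Lemma local_common_divisor (P : maxIdeal R) n (a : 'I_n.+1 -> R) :
  exists i u, u \in maxi_compl P /\ forall k, exists c, u * a k = c * a i.
Proof.
pose phi := locscal (maxi_compl P).
have [i iP] := chain_ring_divides_all (fun k => phi (a k)) (valuation_chain_ring (@R_arith P)).
have /choice[u uP] k : exists u, u \in maxi_compl P /\ exists c, u * a k = c * a i.
  have [g] := iP k; rewrite -(fracK g); move: (loc_num g) (loc_den g) => c t.
  rewrite -[_ * _]/((frac c t : locring _) *: (frac (a i : R^o) (denom1 _) :
    locmod (maxi_compl P) R^o)) fracZ => /fracP[u uP].
  rewrite -[_ *: (a k : R^o)]/((u * (sval t * 1)) * a k).
  rewrite -[_ *: (_ : R^o)]/(u * 1 * (c * a i)) !mulr1 => e.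
  by exists (u * sval t); split; [rewrite rpredM // (svalP t) | exists (u * c); rewrite e mulrA].
exists i, (\prod_k u k); split; first by apply: rpred_prod => k _; case: (uP k).
move=> k; have [_ [c ce]] := uP k; rewrite (bigD1 k) //= mulrAC ce.
by exists (c * \prod_(l | l != k) u l); rewrite mulrAC.
Qed.

(** The scalars carrying the relation module into a finitely generated submodule of itself form the
    ideal [L]. If it were proper, it would lie in some [P], but explicit relations at [P] give an
    element of [L] outside [P]. *)
Lemma locally_coherent_coherent : coherent R.
Proof.
move=> I [n [g gP]].
have lp : linear (fun v : 'rV[R]_n => \sum_i v 0 i *: g i).
  move=> r v w; rewrite scaler_sumr -big_split /=; apply: eq_bigr => i _.
  by rewrite !mxE scalerDl scalerA.
pose p : {linear 'rV[R]_n -> submod I} := linear_of lp.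
exists n, p; split.
  move=> x; have [c ->] := gP x; exists (\row_i c i).
  by apply: eq_bigr => i _; rewrite mxE.
pose L : set R^o := fun u => exists m (k : 'I_m -> 'rV[R]_n),
  (forall i, k i \in ker p) /\ forall v, v \in ker p -> combinations k ((u : R) *: v).
have clL : closed_under_lin L.
  split.
    exists 0, (fun=> 0); split=> [[]//|v _]; rewrite scale0r.
    by case: (combinations_closed (fun _ : 'I_0 => 0 : 'rV[R]_n)).
  move=> r u u' [m [k [kK kP]]] [m' [k' [kK' kP']]].
  pose kk (i : 'I_(m + m')) := match fintype.split i with inl l => k l | inr l => k' l end.
  exists (m + m')%N, kk; split=> [i|v vK].
    by rewrite /kk; case: fintype.split.
  have -> : (r *: u + u' : R) *: v = r *: ((u : R) *: v) + (u' : R) *: v.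
    by rewrite scalerDl -scalerA.
  apply: (proj2 (combinations_closed kk)).
    apply: (combinations_sub (combinations_closed kk)) (kP v vK) => i.
    by have := combinations_gen kk (unsplit (inl i)); rewrite /kk unsplitK.
  apply: (combinations_sub (combinations_closed kk)) (kP' v vK) => i.
  by have := combinations_gen kk (unsplit (inr i)); rewrite /kk unsplitK.
have [[m [k [kK kP]]]|L1] := pselect (L 1).
  apply: (@fin_gen_submod _ _ (ker p) m k) => v; split.
    by move/kP; rewrite scale1r.
  exact: (combinations_sub (submod_closed_under_lin (ker p)) kK).
have [P LP] := maximal_ideal_above clL L1.
(* Without generators the relation module is zero; the common divisor below requires at least
   one. *)
case: n g gP lp @p @L clL L1 P LP => [|n] g gP lp p L clL L1 P LP.
  case: L1; exists 0, (fun=> 0); split=> [[]//|v _].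
  by exists (fun=> 0); rewrite big_ord0; apply/rowP => -[].
pose a i : R := val (g i).
have [i0 [u [uP uc]]] := local_common_divisor P a.
have [c cP] := choice uc.
have [s [u' [sa uP' u'P]]] := uniform_local_annihilator P (a i0).
have pE v : val (p v) = \sum_i v 0 i * a i.
  by rewrite /p linear_ofE raddf_sum; apply: eq_bigr => i _.
have kerE v : v \in ker p <-> \sum_i v 0 i * a i = 0.
  rewrite unfold_in -pE; split=> [/eqP -> //|e].
  by apply/eqP/val_inj; rewrite e.
have pd i : val (p (delta_mx 0 i)) = a i.
  rewrite pE (bigD1 i) //= mxE !eqxx mul1r big1 ?addr0 // => l li.
  by rewrite mxE eqxx (negPf li) mul0r.
(* Index 0 holds the relation s a_i0 = 0; the others express each [a l] through the common divisor
   [a i0]. *)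
pose k (i : 'I_n.+2) : 'rV[R]_n.+1 :=
  if unlift ord0 i is Some l then u *: delta_mx 0 l - c l *: delta_mx 0 i0
  else s *: delta_mx 0 i0.
have kl l : u *: delta_mx 0 l - c l *: delta_mx 0 i0 = k (lift ord0 l).
  by rewrite /k liftK.
have k0 : s *: delta_mx 0 i0 = k ord0 by rewrite /k unlift_none.
have : u' * u \in maxi_compl P by rewrite rpredM.
move/negP; case; apply: LP; exists n.+2, k; split.
  move=> i; rewrite unfold_in; apply/eqP/val_inj; rewrite /k; case: unliftP => [l _|_].
    have -> : p (u *: delta_mx 0 l - c l *: delta_mx 0 i0) =
        u *: p (delta_mx 0 l) - c l *: p (delta_mx 0 i0) by rewrite linearB !linearZ.
    change (u * val (p (delta_mx 0 l)) - c l * val (p (delta_mx 0 i0)) = 0).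
    by rewrite !pd cP subrr.
  have -> : p (s *: delta_mx 0 i0) = s *: p (delta_mx 0 i0) by rewrite linearZ.
  change (s * val (p (delta_mx 0 i0)) = 0).
  by rewrite pd.
move=> v /kerE va.
(* Modulo the relations at nonzero indices, u v is the multiple of the basis vector [i0] by the sum
   of the v_i c_i, which annihilates [a i0]. *)
have [d dE] : exists d, u' * (\sum_i v 0 i * c i) = d * s.
  apply: u'P; transitivity (u * \sum_i v 0 i * a i); last by rewrite va mulr0.
  rewrite mulr_suml mulr_sumr.
  by apply: eq_bigr => i _; rewrite mulrCA cP mulrA.
have vE : (u' * u) *: v = \sum_i (u' * v 0 i) *: k (lift ord0 i) + d *: k ord0.
  rewrite -k0 scalerA -dE mulr_sumr scaler_suml -big_split /=.
  rewrite {1}(row_sum_delta v) scaler_sumr; apply: eq_bigr => i _.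
  by rewrite -kl scalerBr !scalerA [u' * (v 0 i * c i)]mulrA subrK; congr (_ *: _); ring.
rewrite vE; apply: closed_addr; first exact: combinations_closed.
  apply: closed_sum => [|i _]; first exact: combinations_closed.
  by apply: closed_scaler; [exact: combinations_closed | exact: combinations_gen].
by apply: closed_scaler; [exact: combinations_closed | exact: combinations_gen].
Qed.

End Coherence.

Theorem corollary7 (R : comPzRingType)
  (R_arith : arithmetical R)
  (R_loc : forall P : maxIdeal R,
     coherent (loc_at P) \/ ~ semicoherent (loc_at P))
  (R_goldie : forall M : lmodType R, fin_gen M -> finite_goldie_dim M) :
  (forall S : mulrClosed R,
     (forall G : lmodType R,
        finitely_injective G ->
        finitely_injective (locmod S G : lmodType (locring S))) /\
     (forall G : lmodType R,
        FP_injective G ->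
        FP_injective (locmod S G : lmodType (locring S)))) /\
  ((forall P : maxIdeal R, coherent (loc_at P)) -> coherent R).
Proof.
split=> [S|R_coh]; last exact: locally_coherent_coherent.
split=> G; first exact: finitely_injective_localization.
move=> /FP_injective_solvable_systems solG; apply/FP_injective_solvable_systems.
exact: solvable_systems_localization.
Qed.
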